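(* Let $\mathfrak{F}\subset B(\mathcal{X})$ satisfy $\{f\in L_b(\mathcal{X}):\|f\|_\infty\le1\}\subset\mathfrak{F}$ and Hypothesis $(\mathbf{H_2})$. Then the following are equivalent: (i) $\Phi$ is uniformly asymptotically stable with respect to $\mathfrak{F}$; (ii) $\Phi$ is uniformly eventually continuous with respect to $\mathfrak{F}$ on $\mathcal{X}$, and there exists $z\in\mathcal{X}$ such that $\Phi$ satisfies $(\mathcal{C}_1)$ at $z$; (iii) there exists $z\in\mathcal{X}$ such that $\Phi$ is uniformly eventually continuous with respect to $\mathfrak{F}$ at $z$ and satisfies $(\mathcal{C}_1)$ at $z$.
   Context: Standing setting: $(\mathcal{X},\rho)$ is a Polish space; $\Phi=\{\Phi_t\}_{t\ge0}$ is a càdlàg Feller Markov process on $\mathcal{X}$ (hence strong Markov), realized as a Markov family with laws $\mathbb{P}^x$, expectations $\mathbb{E}^x$, and transition kernels $P_t(x,\cdot)$. $B(\mathcal{X})$: Borel real functions; $L_b(\mathcal X)$: bounded Lipschitz functions; $B(z,r)$: open ball; $\langle f,\mu\rangle=\int f\,d\mu$. $\mathcal{A}=\{f\in B(\mathcal{X}):\int|f|\,dP_t(x,\cdot)<\infty\ \forall x,t\}$, $P_tf(x)=\int f\,dP_t(x,\cdot)$ for $f\in\mathcal A$. Invariant measure: $\int P_t(x,\cdot)\mu(dx)=\mu$ for all $t$. Definitions: $\Phi$ is uniformly asymptotically stable with respect to $\mathfrak F$ if it has a unique invariant probability measure $\mu$, $\mathfrak F\subset L^1(\mu)$, and $\lim_{t\to\infty}\sup_{f\in\mathfrak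 F}|P_tf(x)-\langle f,\mu\rangle|=0$ for all $x$. $(\mathcal C_1)$ at $z$: for every $r>0$, $\inf_{x\in\mathcal X}\liminf_{t\to\infty}P_t(x,B(z,r))>0$. For $\mathfrak F\subset\mathcal A$, $\Phi$ is uniformly eventually continuous with respect to $\mathfrak F$ at $x$ if $\limsup_{x'\to x}\limsup_{t\to\infty}\sup_{f\in\mathfrak F}|P_tf(x')-P_tf(x)|=0$; ''on $\mathcal X$'' means at every point. Uniform integrability of $\{\xi_t\}$: $\lim_{K\to\infty}\sup_t\mathbb E(|\xi_t|\chi_{\{|\xi_t|\ge K\}})=0$. Hypothesis $(\mathbf{H_2})$: there is $V\in\mathcal A$ with $|f(x)|\le V(x)$ for all $f\in\mathfrak F$, $x\in\mathcal X$, such that $\{V(\Phi_t)\}_{t\ge0}$ is uniformly integrable under $\mathbb P^x$ for every $x$. *)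

(* Defs.v *)
From mathcomp Require Import all_boot all_order all_algebra.
From mathcomp Require Import all_classical all_reals all_analysis.
From mathcomp Require Import measurable_realfun.
Import numFieldNormedType.Exports.
Set Implicit Arguments. Unset Strict Implicit. Unset Printing Implicit Defensive.
Import Order.TTheory GRing.Theory Num.Theory.
Local Open Scope classical_set_scope.
Local Open Scope ring_scope.

Section metric.
Context {R : realType} {X : Type} (rho : X -> X -> R).

Definition mk_is_metric : Prop :=
  [/\ (forall x y, 0 <= rho x y), (forall x y, rho x y = 0 <-> x = y),
      (forall x y, rho x y = rho y x) &
      (forall x y z, rho x z <= rho x y + rho y z)].

Definition mk_rball (z : X) (r : R) : set X := [set x | rho z x < r].

Definition mk_rho_open (A : set X) : Prop :=
  forall x, A x -> exists2 r, 0 < r & mk_rball x r `<=` A.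

Definition mk_rho_complete : Prop :=
  forall u : nat -> X,
    (forall e, 0 < e -> exists N, forall m n, (N <= m)%N -> (N <= n)%N ->
        rho (u m) (u n) < e) ->
    exists l, forall e, 0 < e -> exists N, forall n, (N <= n)%N -> rho l (u n) < e.

Definition mk_rho_separable : Prop :=
  exists s : nat -> X, forall x e, 0 < e -> exists n, rho x (s n) < e.

Definition mk_polish : Prop := [/\ mk_is_metric, mk_rho_complete & mk_rho_separable].

Definition mk_rho_continuous_at (f : X -> R) (x : X) : Prop :=
  forall e, 0 < e -> exists2 dl, 0 < dl & forall y, rho x y < dl -> `|f y - f x| < e.

Definition mk_bounded_continuous (f : X -> R) : Prop :=
  (exists M, forall x, `|f x| <= M) /\ (forall x, mk_rho_continuous_at f x).

Definition mk_lipschitz (f : X -> R) : Prop :=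
  exists L, forall x y, `|f x - f y| <= L * rho x y.

End metric.

Definition mk_borel_of {R : realType} {d} {X : measurableType d} (rho : X -> X -> R) : Prop :=
  forall A : set X, measurable A <-> <<s mk_rho_open rho >> A.

Section process.
Context {R : realType} {d : measure_display} {X : measurableType d}
  {dO : measure_display} {Om : measurableType dO}
  (P : X -> probability Om R) (Phi : R -> Om -> X).

Local Open Scope ereal_scope.

Definition mk_Pt (t : R) (x : X) (B : set X) : \bar R := P x (Phi t @^-1` B).

(* P_t f(x) = int f dP_t(x,.) = E^x f(Phi_t) *)
Definition mk_Ptf (t : R) (f : X -> R) (x : X) : \bar R :=
  \int[P x]_w (f (Phi t w))%:E.

Definition mk_in_A (f : X -> R) : Prop :=
  measurable_fun setT f /\
  forall x t, (0 <= t)%R -> \int[P x]_w `|f (Phi t w)|%:E < +oo.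

Definition mk_markov_family : Prop :=
  [/\ (forall t, (0 <= t)%R -> measurable_fun setT (Phi t)),
      (forall x, P x (Phi 0%R @^-1` [set x]) = 1),
      (forall t B, (0 <= t)%R -> measurable B ->
         measurable_fun setT (fun x => mk_Pt t x B)) &
      (* Markov property w.r.t. the natural filtration *)
      (forall x s t, (0 <= s)%R -> (0 <= t)%R ->
       forall (n : nat) (u : nat -> R) (A : nat -> set X) (B : set X),
         (forall i, (0 <= u i <= s)%R) -> (forall i, measurable (A i)) ->
         measurable B ->
         P x (\bigcap_(i in `I_n) (Phi (u i) @^-1` A i) `&` Phi (s + t)%R @^-1` B)
         = \int[P x]_(w in \bigcap_(i in `I_n) (Phi (u i) @^-1` A i))
              mk_Pt t (Phi s w) B)].

End process.

Section process_metric.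
Context {R : realType} {d : measure_display} {X : measurableType d}
  {dO : measure_display} {Om : measurableType dO}
  (rho : X -> X -> R) (P : X -> probability Om R) (Phi : R -> Om -> X).

Local Open Scope ereal_scope.

Definition mk_feller : Prop :=
  forall t, (0 <= t)%R -> forall f, mk_bounded_continuous rho f ->
    forall x, mk_rho_continuous_at rho (fun y => fine (mk_Ptf P Phi t f y)) x.

Definition mk_cadlag : Prop :=
  forall w t, (0 <= t)%R ->
    (forall e, (0 < e)%R -> exists2 dl, (0 < dl)%R &
        forall s, (t <= s < t + dl)%R -> (rho (Phi t w) (Phi s w) < e)%R) /\
    ((0 < t)%R -> exists l, forall e, (0 < e)%R -> exists2 dl, (0 < dl)%R &
        forall s, (0 <= s)%R -> (t - dl < s < t)%R -> (rho l (Phi s w) < e)%R).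

Definition mk_cadlag_feller_markov : Prop :=
  [/\ mk_markov_family P Phi, mk_feller & mk_cadlag].

Definition mk_invariant (mu : probability X R) : Prop :=
  forall t B, (0 <= t)%R -> measurable B ->
    \int[mu]_x mk_Pt P Phi t x B = mu B.

Definition mk_unif_asympt_stable (F : set (X -> R)) : Prop :=
  exists mu : probability X R,
    [/\ mk_invariant mu,
        (forall nu : probability X R, mk_invariant nu ->
           forall B, measurable B -> nu B = mu B),
        (forall f, F f -> mu.-integrable setT (EFin \o f)) &
        (forall x, (fun t => ereal_sup
            [set `|mk_Ptf P Phi t f x - \int[mu]_y (f y)%:E| | f in F])
            @ pinfty_nbhs R --> 0)].

Definition mk_C1 (z : X) : Prop :=
  forall r, (0 < r)%R ->
    0 < ereal_inf [set limf_einf (fun t : R => mk_Pt P Phi t x (mk_rball rho z r))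
                                 (pinfty_nbhs R) | x in setT].

(* uniform eventual continuity w.r.t. F at x:
   limsup_{x' -> x} limsup_{t -> oo} sup_{f in F} |P_t f(x') - P_t f(x)| = 0 *)
Definition mk_unif_ev_continuous_at (F : set (X -> R)) (x : X) : Prop :=
  ereal_inf [set ereal_sup
      [set limf_esup (fun t : R => ereal_sup
             [set `|mk_Ptf P Phi t f x' - mk_Ptf P Phi t f x| | f in F])
           (pinfty_nbhs R) | x' in mk_rball rho x dl]
    | dl in [set dl : R | (0 < dl)%R]] = 0.

Definition mk_unif_ev_continuous (F : set (X -> R)) : Prop :=
  forall x, mk_unif_ev_continuous_at F x.

Definition mk_H2 (F : set (X -> R)) : Prop :=
  exists V : X -> R,
    [/\ mk_in_A P Phi V,
        (forall f x, F f -> (`|f x| <= V x)%R) &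
        (forall x, (fun K : R => ereal_sup
            [set \int[P x]_(w in [set w | (K <= `|V (Phi t w)|)%R])
                   `|V (Phi t w)|%:E | t in [set t : R | (0 <= t)%R]])
            @ pinfty_nbhs R --> 0)].

End process_metric.

(* Main.v *)
Require Import Defs.
From HB Require Import structures.
From mathcomp Require Import all_boot all_order all_algebra.
From mathcomp Require Import all_classical all_reals all_analysis.
From mathcomp Require Import measurable_realfun.
From mathcomp Require Import ring lra.
Import numFieldNormedType.Exports.
Import Order.TTheory GRing.Theory Num.Theory.
Local Open Scope classical_set_scope.
Local Open Scope ring_scope.

Set Implicit Arguments.
Unset Strict Implicit.
Unset Printing Implicit Defensive.

(** The family of Lipschitz functions bounded by 1 carries no bound on the
    Lipschitz constants, so its uniform distance is the total variation
    distance, and it is reached by a countable subfamily: [dtv (K t x) (K t y)]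
    is measurable in [x], lower semicontinuous by the Feller property, and
    nonincreasing in [t], where [K t x] is the law of [Phi t] under [P x].

    Coalescence.  Let [b] bound [lim_t dtv (K t x) (K t y)] for all [x], [y].
    Near [z] the limit is at most [2 eps], and both [K n x] and [K n y] charge
    a ball around [z] with mass at least [p]; coupling them independently at
    time [n] improves [b] to [b - p^2 (b - 2 eps)].  Hence the limit is 0.

    Existence.  A generalized limit [nu] of the laws [K n z] is a finitely
    additive invariant content.  The laws [K n z] are carried by the closed set
    of points all of whose balls are charged by [nu] (Feller), and Baire's
    theorem on that set gives a ball on which [dtv (K k y) (K k z) <= 1/2] for
    a single [k]; so [nu >= beta (K k z - 1/2)] and the largest countably
    additive minorant of [nu] is nonzero.  By maximality it is invariant.

    Coalescence then gives uniqueness and total variation convergence, and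
    truncation at a level controlled by uniform integrability passes to [F]. *)

(** * Expectations of bounded measurable functions *)

Section expectation.
Context {R : realType} {d : measure_display} {X : measurableType d}.
Implicit Types (mu nu : probability X R) (f g : X -> R) (B : set X).

Definition bdd_meas f :=
  measurable_fun setT f /\ exists M, forall x, `|f x| <= M.

Definition unit_meas f :=
  measurable_fun setT f /\ forall x, 0 <= f x <= 1.

Definition expect mu f : R := (\int[mu]_x f x)%R.

Lemma unit_meas_bdd f : unit_meas f -> bdd_meas f.
Proof.
by move=> [mf f01]; split => //; exists 1 => x; have /andP[? ?] := f01 x; rewrite ger0_norm.
Qed.

Lemma bdd_meas_cst (c : R) : bdd_meas (cst c).
Proof. by split; [exact: measurable_cst|exists `|c|]. Qed.

Lemma bdd_measD f g : bdd_meas f -> bdd_meas g -> bdd_meas (fun x => f x + g x).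
Proof.
move=> [mf [M hM]] [mg [N hN]]; split; first exact: measurable_funD.
by exists (M + N) => x; rewrite (le_trans (ler_normD _ _))// lerD.
Qed.

Lemma bdd_measZ (c : R) f : bdd_meas f -> bdd_meas (fun x => c * f x).
Proof.
move=> [mf [M hM]]; split; first exact: measurable_funM.
by exists (`|c| * M) => x; rewrite normrM ler_wpM2l.
Qed.

Lemma bdd_measB f g : bdd_meas f -> bdd_meas g -> bdd_meas (fun x => f x - g x).
Proof.
move=> [mf [M hM]] [mg [N hN]]; split; first exact: measurable_funB.
by exists (M + N) => x; rewrite (le_trans (ler_normB _ _))// lerD.
Qed.

Lemma bdd_meas_norm f : bdd_meas f -> bdd_meas (fun x => `|f x|).
Proof.
move=> [mf [M hM]]; split; first exact: measurableT_comp.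
by exists M => x; rewrite normr_id.
Qed.

Lemma unit_meas_indic B : measurable B -> unit_meas (\1_B).
Proof.
move=> mB; split; first exact: measurable_indic.
by move=> x; rewrite indicE; case: (x \in B); rewrite /= lexx ler01.
Qed.

Lemma bdd_meas_indic B : measurable B -> bdd_meas (\1_B).
Proof. by move=> mB; apply: unit_meas_bdd; exact: unit_meas_indic. Qed.

Lemma bdd_meas_integrable mu f : bdd_meas f -> mu.-integrable setT (EFin \o f).
Proof.
move=> [mf [M hM]]; apply: measurable_bounded_integrable => //.
  by apply: le_lt_trans (probability_le1 mu measurableT) _; exact: ltry.
exists M; split; first exact: num_real.
by move=> N MN x _; exact: le_trans (hM x) (ltW MN).
Qed.

Lemma EFin_expect mu f : bdd_meas f ->
  (expect mu f)%:E = (\int[mu]_x (f x)%:E)%E.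
Proof.
by move=> bf; rewrite /expect /Rintegral fineK//; apply: integrable_fin_num => //;
  exact: bdd_meas_integrable.
Qed.

Lemma expectD mu f g : bdd_meas f -> bdd_meas g ->
  expect mu (fun x => f x + g x) = expect mu f + expect mu g.
Proof. by move=> bf bg; rewrite /expect RintegralD//; exact: bdd_meas_integrable. Qed.

Lemma expectB mu f g : bdd_meas f -> bdd_meas g ->
  expect mu (fun x => f x - g x) = expect mu f - expect mu g.
Proof. by move=> bf bg; rewrite /expect RintegralB//; exact: bdd_meas_integrable. Qed.

Lemma expectZ mu (c : R) f : bdd_meas f ->
  expect mu (fun x => c * f x) = c * expect mu f.
Proof. by move=> bf; rewrite /expect RintegralZl//; exact: bdd_meas_integrable. Qed.

Lemma expect_cst mu (c : R) : expect mu (cst c) = c.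
Proof. rewrite /expect Rintegral_cst//.
have -> : fine (mu setT) = 1 by rewrite (probability_setT mu).
by rewrite mulr1. Qed.

Lemma expect_indic mu B : measurable B -> expect mu (\1_B) = fine (mu B).
Proof. by move=> mB; rewrite /expect /Rintegral integral_indic// setIT. Qed.

Lemma le_expect mu f g : bdd_meas f -> bdd_meas g -> (forall x, f x <= g x) ->
  expect mu f <= expect mu g.
Proof. by move=> bf bg fg; apply: le_Rintegral => //; exact: bdd_meas_integrable. Qed.

Lemma expect_le_cst mu f (c : R) : bdd_meas f -> (forall x, f x <= c) ->
  expect mu f <= c.
Proof.
by move=> bf fc; rewrite -[leRHS](expect_cst mu); apply: le_expect => //; exact: bdd_meas_cst.
Qed.

Lemma expect_ge_cst mu f (c : R) : bdd_meas f -> (forall x, c <= f x) ->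
  c <= expect mu f.
Proof.
by move=> bf fc; rewrite -[leLHS](expect_cst mu); apply: le_expect => //; exact: bdd_meas_cst.
Qed.

Lemma expect_unit mu f : unit_meas f -> 0 <= expect mu f <= 1.
Proof.
move=> uf; have bf := unit_meas_bdd uf; apply/andP; split.
  by apply: expect_ge_cst => // x; have /andP[] := uf.2 x.
by apply: expect_le_cst => // x; have /andP[] := uf.2 x.
Qed.

Lemma expect_norm mu f : bdd_meas f -> `|expect mu f| <= expect mu (fun x => `|f x|).
Proof. by move=> bf; apply: le_normr_Rintegral => //; exact: bdd_meas_integrable. Qed.

Lemma expect_dist mu f g (e : R) : bdd_meas f -> bdd_meas g ->
  (forall x, `|f x - g x| <= e) -> `|expect mu f - expect mu g| <= e.
Proof.
move=> bf bg h; rewrite -expectB//; apply: le_trans (expect_norm _ _) _; first exact: bdd_measB.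
by apply: expect_le_cst => //; apply: bdd_meas_norm; exact: bdd_measB.
Qed.

Lemma bounded_convergence mu (f_ : nat -> X -> R) f (M : R) :
  (forall n, measurable_fun setT (f_ n)) -> (forall n x, `|f_ n x| <= M) ->
  (forall x, (f_ n x) @[n --> \oo] --> f x) ->
  expect mu (f_ n) @[n --> \oo] --> expect mu f.
Proof.
move=> mf_ fM cf.
have mf : measurable_fun setT f by apply: measurable_fun_cvg (fun x _ => cf x).
have [] := @dominated_convergence _ _ _ mu setT measurableT
  (fun n x => (f_ n x)%:E) (EFin \o f) (cst M%:E).
- by move=> n; apply/measurable_EFinP.
- exact/measurable_EFinP.
- by apply: aeW => x _; apply: cvg_EFin; [exact: nearW|exact: cf].
- by apply: (@bdd_meas_integrable mu (cst M)); exact: bdd_meas_cst.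
- by apply: aeW => x n _; rewrite lee_fin.
move=> intf _ h; apply: fine_cvg; rewrite fineK; last exact: integrable_fin_num intf.
exact: h.
Qed.

End expectation.

Lemma exists_natSinv_lt {R : realType} (e : R) : 0 < e -> exists N : nat, N.+1%:R^-1 < e.
Proof.
move=> e0; have [N _ hN] := near_infty_natSinv_lt (PosNum e0).
by exists N; exact: hN N (leqnn N).
Qed.

Lemma half_pos {R : realType} (e : R) : 0 < e -> 0 < e / 2.
Proof. by move=> e0; rewrite divr_gt0. Qed.

(** * Layer-cake approximation, from sets to functions *)

Section staircase.
Context {R : realType} {d : measure_display} {X : measurableType d}.
Implicit Types (mu nu : probability X R) (f g : X -> R) (B : set X).

Definition stair_level N f (k : nat) : set X := [set x | (k.+1%:R / N%:R <= f x)].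

(** A discrete layer-cake formula: up to 1/N, a function with values in [0,1] is the average of the
    indicators of [N] superlevel sets. It carries relations known on sets over to functions, also
    for functionals that are only finitely additive. *)
Definition stair (N : nat) f (x : X) : R :=
  N%:R^-1 * \sum_(k < N) \1_(stair_level N f k) x.

(** The sum counts the positive integers not exceeding [y], so it is the integer part of [y]. *)
Lemma count_le_floor (N : nat) (y : R) : 0 <= y <= N%:R ->
  y - 1 <= \sum_(k < N) (k.+1%:R <= y)%R%:R <= y.
Proof.
have full n : n%:R <= y -> \sum_(k < n) (k.+1%:R <= y)%R%:R = n%:R :> R.
  elim: n => [|n IH] ny; first by rewrite big_ord0.
  by rewrite big_ord_recr /= ny IH ?natr1// (le_trans _ ny)// ler_nat.
elim: N => [|n IH] /andP[y0 yn].
  by rewrite big_ord0; apply/andP; split; lra.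
have [yn1|yn1] := leP y n%:R.
  rewrite big_ord_recr /=.
  have -> : (n.+1%:R <= y) = false.
    by apply/negbTE; rewrite -ltNge (le_lt_trans yn1)// ltr_nat.
  by rewrite addr0; apply: IH; rewrite y0.
rewrite big_ord_recr /= full; last exact: ltW.
rewrite -natr1 in yn *.
by have [h|h] := leP (n%:R + 1) y; rewrite ?mulr0n ?mulr1n; apply/andP; split; lra.
Qed.

Lemma stair_approx N f x : (0 < N)%N -> 0 <= f x <= 1 ->
  `|f x - stair N f x| <= N%:R^-1.
Proof.
move=> N0 /andP[f0 f1]; have N0' : (0 : R) < N%:R by rewrite ltr0n.
have h : 0 <= N%:R * f x <= N%:R.
  by apply/andP; split; [exact: mulr_ge0 (ltW N0') f0|rewrite ger_pMr].
have := count_le_floor h.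
rewrite /stair; set s := \sum_(k < N) _; set s' := \sum_(k < N) _.
have -> : s = s'.
  apply: eq_bigr => k _; rewrite indicE /stair_level; congr (_%:R).
  by congr nat_of_bool; apply/idP/idP; rewrite inE /= ler_pdivrMr// mulrC.
move=> /andP[h1 h2].
have -> : f x - N%:R^-1 * s' = N%:R^-1 * (N%:R * f x - s').
  by rewrite mulrBr mulrA mulVf ?mul1r// gt_eqF.
rewrite normrM ger0_norm ?invr_ge0// ler_piMr ?invr_ge0// ler_norml.
by apply/andP; split; lra.
Qed.

Lemma measurable_stair_level N f k :
  measurable_fun setT f -> measurable (stair_level N f k).
Proof.
move=> mf; rewrite /stair_level -[X in measurable X]setTI.
exact: (measurable_fun_le measurableT (measurable_cst _) mf).
Qed.

Lemma bdd_meas_sum n (F : nat -> X -> R) : (forall k, bdd_meas (F k)) ->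
  bdd_meas (fun x => \sum_(k < n) F k x).
Proof.
move=> bF; elim: n => [|n IH].
  by under eq_fun do rewrite big_ord0; exact: bdd_meas_cst.
by under eq_fun do rewrite big_ord_recr/=; exact: bdd_measD.
Qed.

Lemma expect_sum mu n (F : nat -> X -> R) : (forall k, bdd_meas (F k)) ->
  expect mu (fun x => \sum_(k < n) F k x) = \sum_(k < n) expect mu (F k).
Proof.
move=> bF; elim: n => [|n IH].
  by rewrite big_ord0; under eq_fun do rewrite big_ord0; exact: expect_cst.
rewrite big_ord_recr/= -IH -expectD//; last exact: bdd_meas_sum.
by congr expect; apply/funext => x; rewrite big_ord_recr.
Qed.

Lemma bdd_meas_stair N f : measurable_fun setT f -> bdd_meas (stair N f).
Proof.
move=> mf; apply: bdd_measZ.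
apply: (@bdd_meas_sum N (fun k => \1_(stair_level N f k))) => k.
by apply: bdd_meas_indic; exact: measurable_stair_level.
Qed.

Lemma expect_stair mu N f : measurable_fun setT f ->
  expect mu (stair N f) =
  N%:R^-1 * \sum_(k < N) fine (mu (stair_level N f k)).
Proof.
move=> mf.
have bl k : bdd_meas (\1_(stair_level N f k) : X -> R).
  by apply: bdd_meas_indic; exact: measurable_stair_level.
rewrite /stair expectZ; last exact: (@bdd_meas_sum N (fun k => \1_(stair_level N f k))).
rewrite (expect_sum mu N bl); congr (_ * _).
by apply: eq_bigr => k _; rewrite expect_indic//; exact: measurable_stair_level.
Qed.

Lemma unit_meas_stair_dist mu N f : unit_meas f ->
  `|expect mu f - expect mu (stair N.+1 f)| <= N.+1%:R^-1.
Proof.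
move=> uf; apply: expect_dist; first exact: unit_meas_bdd.
  by apply: bdd_meas_stair; exact: uf.1.
by move=> x; apply: stair_approx => //; exact: uf.2.
Qed.

(** The weights in [stair] sum to 1, so a bound on sets passes to [stair] with the same constant
    [D]; the two approximation errors vanish with [N]. *)
Lemma expect_close mu nu (D : R) :
  (forall B, measurable B -> `|fine (mu B) - fine (nu B)| <= D) ->
  forall f, unit_meas f -> `|expect mu f - expect nu f| <= D.
Proof.
move=> h f uf; apply/ler_addgt0Pr => e e0.
have [N hN] := exists_natSinv_lt (half_pos e0).
have h1 := unit_meas_stair_dist mu N uf; have h2 := unit_meas_stair_dist nu N uf.
have h3 : `|expect mu (stair N.+1 f) - expect nu (stair N.+1 f)| <= D.
  rewrite (expect_stair mu N.+1 uf.1) (expect_stair nu N.+1 uf.1).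
  rewrite -mulrBr normrM ger0_norm ?invr_ge0// -sumrB.
  rewrite ler_pdivrMl ?ltr0n//.
  apply: le_trans (ler_norm_sum _ _ _) _.
  apply: (@le_trans _ _ (\sum_(i < N.+1) D)).
    by apply: ler_sum => i _; apply: h; apply: measurable_stair_level; exact: uf.1.
  by rewrite sumr_const card_ord mulr_natl.
move: hN h1 h2 h3; set q := (N.+1%:R^-1 : R); move: q => q hN.
rewrite !ler_norml => /andP[? ?] /andP[? ?] /andP[? ?].
by apply/andP; split; lra.
Qed.

End staircase.

(** * Total variation as a supremum over a countable family of Lipschitz functions *)

Lemma ler_dist_max {R : realType} (a b c e : R) :
  `|Num.max a b - Num.max c e| <= `|a - c| + `|b - e|.
Proof.
have := ler_norm (a - c); have := ler_norm (b - e).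
have := ler_norm (c - a); have := ler_norm (e - b).
rewrite (distrC c a) (distrC e b) => h1 h2 h3 h4.
have := normr_ge0 (a - c); have := normr_ge0 (b - e).
rewrite ler_norml /Num.max => h5 h6.
by case: ltP => ?; case: ltP => ?; apply/andP; split; lra.
Qed.

Lemma ler_dist_min1 {R : realType} (a b : R) :
  `|Num.min 1 a - Num.min 1 b| <= `|a - b|.
Proof.
have := ler_norm (a - b); have := ler_norm (b - a); rewrite (distrC b a) => h1 h2.
have h5 := normr_ge0 (a - b).
by rewrite ler_norml /Num.min; case: ltP => ?; case: ltP => ?; apply/andP; split; lra.
Qed.

Section lipschitz.
Context {R : realType} {d : measure_display} {X : measurableType d}.
Context (rho : X -> X -> R) (rho_metric : mk_is_metric rho).
Implicit Types (f g : X -> R).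

Lemma rho_ge0 x y : 0 <= rho x y. Proof. by case: rho_metric. Qed.
Lemma rho_xx x : rho x x = 0. Proof. by case: rho_metric => _ h _ _; apply/h. Qed.
Lemma rho_sym x y : rho x y = rho y x. Proof. by case: rho_metric. Qed.
Lemma rho_tri y x z : rho x z <= rho x y + rho y z. Proof. by case: rho_metric. Qed.

Lemma mk_rball_open x r : mk_rho_open rho (mk_rball rho x r).
Proof.
move=> y /= xy; exists (r - rho x y); first by rewrite subr_gt0.
by move=> w /= yw; rewrite /mk_rball /= in xy yw *; have := rho_tri y x w; lra.
Qed.

Lemma lipschitz_cst (c : R) : mk_lipschitz rho (cst c).
Proof. by exists 0 => x y; rewrite subrr normr0 mul0r. Qed.

Lemma lipschitz_compl f : mk_lipschitz rho f -> mk_lipschitz rho (fun x => 1 - f x).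
Proof.
by move=> [L hL]; exists L => x y; rewrite opprB addrC addrA subrK distrC.
Qed.

Lemma lipschitz_max f g : mk_lipschitz rho f -> mk_lipschitz rho g ->
  mk_lipschitz rho (fun x => Num.max (f x) (g x)).
Proof.
move=> [L hL] [M hM]; exists (L + M) => x y.
by apply: le_trans (ler_dist_max _ _ _ _) _; rewrite mulrDl lerD.
Qed.

(** A ramp of slope [k] cut at 1: Lipschitz, zero off the ball of radius [q], and tending to the
    indicator of the open ball as [k] grows. *)
Definition tent (z : X) (q k : R) x := Num.min 1 (k * Num.max 0 (q - rho z x)).

Lemma tent_unit z q k x : 0 <= k -> 0 <= tent z q k x <= 1.
Proof.
by move=> k0; rewrite le_min ler01 ge_min lexx mulr_ge0// le_max lexx.
Qed.

Lemma lipschitz_tent z q k : 0 <= k -> mk_lipschitz rho (tent z q k).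
Proof.
move=> k0; exists k => x y; apply: le_trans (ler_dist_min1 _ _) _.
rewrite -mulrBr normrM ger0_norm// ler_wpM2l//.
apply: le_trans (ler_dist_max _ _ _ _) _; rewrite subrr normr0 add0r.
rewrite opprB addrC addrA subrK ler_norml.
have := rho_tri y z x; have := rho_tri x z y; rewrite (rho_sym y x) => ? ?.
by apply/andP; split; lra.
Qed.

Lemma tent_out z q k x : q <= rho z x -> tent z q k x = 0.
Proof.
move=> h; rewrite /tent (_ : Num.max _ _ = 0) ?mulr0; last first.
  by apply/max_idPl; rewrite subr_le0.
by apply/min_idPr; exact: ler01.
Qed.

Lemma tent_eq1 z q k x : 0 <= k -> 1 <= k * (q - rho z x) -> tent z q k x = 1.
Proof.
move=> k0 h; apply/min_idPl; apply: le_trans h _; apply: ler_wpM2l => //.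
by rewrite le_max lexx orbT.
Qed.

Lemma tent_cvg_indic z q x :
  tent z q k%:R x @[k --> \oo] --> (\1_(mk_rball rho z q) x : R).
Proof.
apply: cvg_near_cst; rewrite indicE.
have [|xF] := boolP (x \in mk_rball rho z q).
  rewrite inE /mk_rball /= -subr_gt0 => h.
  near=> k; apply: tent_eq1 => //.
  rewrite -ler_pdivrMr// mul1r.
  by near: k; exact: nbhs_infty_ger.
apply: nearW => k; apply: tent_out; rewrite leNgt; apply/negP => h.
by move/negP: xF; apply; rewrite inE.
Unshelve. all: by end_near.
Qed.

Lemma lipschitz_continuous_at f x : mk_lipschitz rho f -> mk_rho_continuous_at rho f x.
Proof.
move=> [L hL] e e0; have L0 : 0 < `|L| + 1 by rewrite ltr_wpDl.
exists (e / (`|L| + 1)); first exact: divr_gt0.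
move=> y; rewrite ltr_pdivlMr// => h; apply: le_lt_trans (hL y x) _.
rewrite rho_sym; apply: le_lt_trans h; rewrite mulrC ler_wpM2l ?rho_ge0//.
by have := ler_norm L; lra.
Qed.

Lemma lipschitz_unit_bounded_continuous f : mk_lipschitz rho f ->
  (forall x, 0 <= f x <= 1) -> mk_bounded_continuous rho f.
Proof.
move=> Lf f01; split; last by move=> x; exact: lipschitz_continuous_at.
by exists 1 => x; have /andP[? ?] := f01 x; rewrite ger0_norm.
Qed.

Context (borel : mk_borel_of rho).

Lemma open_meas A : mk_rho_open rho A -> measurable A.
Proof. by move=> oA; apply/borel; exact: sub_sigma_algebra. Qed.

Lemma measurable_rball z r : measurable (mk_rball rho z r).
Proof. exact/open_meas/mk_rball_open. Qed.

Lemma continuous_measurable f : (forall x, mk_rho_continuous_at rho f x) ->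
  measurable_fun setT f.
Proof.
move=> cf mT; apply: (measurability _ (RGenOInfty.measurableE R)) => //.
move=> _ [_ [a ->] <-]; rewrite setTI; apply: open_meas => x /=.
rewrite in_itv /= andbT => afx.
have [dl dl0 hdl] := cf x (f x - a) ltac:(by rewrite subr_gt0).
exists dl => // y /hdl /=; rewrite in_itv /= andbT ltr_norml => /andP[? ?].
by lra.
Qed.

Lemma lipschitz_measurable f : mk_lipschitz rho f -> measurable_fun setT f.
Proof.
by move=> Lf; apply: continuous_measurable => x; exact: lipschitz_continuous_at.
Qed.

End lipschitz.

(** Names for a countable set of test functions: ramps around dense points, closed under 1 - f and
    max, which mirror complement and union of sets. Separating syntax from values reduces
    countability to an encoding by finite trees. *)
Inductive lterm := Tent of nat & nat & nat | Compl of lterm | Join of lterm & lterm.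

Fixpoint lterm_encode t : GenTree.tree nat :=
  match t with
  | Tent n m k => GenTree.Node 0 [:: GenTree.Leaf n; GenTree.Leaf m; GenTree.Leaf k]
  | Compl t => GenTree.Node 1 [:: lterm_encode t]
  | Join t u => GenTree.Node 2 [:: lterm_encode t; lterm_encode u]
  end.

Fixpoint lterm_decode (t : GenTree.tree nat) : option lterm :=
  match t with
  | GenTree.Node 0 [:: GenTree.Leaf n; GenTree.Leaf m; GenTree.Leaf k] => Some (Tent n m k)
  | GenTree.Node 1 [:: t] => omap Compl (lterm_decode t)
  | GenTree.Node 2 [:: t; u] =>
    if lterm_decode t is Some t' then omap (Join t') (lterm_decode u) else None
  | _ => None
  end.

Lemma lterm_encodeK : pcancel lterm_encode lterm_decode.
Proof. by elim=> //= [t ->|t -> u ->]. Qed.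

(** Indices that encode no term are sent to an arbitrary one; what matters is surjectivity. *)
Definition lterm_nth (i : nat) : lterm :=
  odflt (Tent 0 0 0) (obind lterm_decode (unpickle i)).

Lemma lterm_nth_surj t : exists i, lterm_nth i = t.
Proof.
exists (pickle (lterm_encode t)).
by rewrite /lterm_nth pickleK /= lterm_encodeK.
Qed.

(** * Approximation in L1 by the countable family, and total variation *)

Section determining_family.
Context {R : realType} {d : measure_display} {X : measurableType d}.
Context (rho : X -> X -> R) (rho_metric : mk_is_metric rho)
  (borel : mk_borel_of rho)
  (s : nat -> X) (s_dense : forall x (e : R), 0 < e -> exists n, rho x (s n) < e).
Implicit Types (mu nu : probability X R) (f g : X -> R) (t u : lterm).

Fixpoint lval t : X -> R :=
  match t with
  | Tent n m k => tent rho (s n) m.+1%:R^-1 k%:R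
  | Compl t => fun x => 1 - lval t x
  | Join t u => fun x => Num.max (lval t x) (lval u x)
  end.

Lemma lval_lipschitz t : mk_lipschitz rho (lval t).
Proof.
elim: t => [n m k|t IH|t IH u IHu] /=.
- exact: lipschitz_tent.
- exact: lipschitz_compl.
- exact: lipschitz_max.
Qed.

Lemma lval_unit t x : 0 <= lval t x <= 1.
Proof.
elim: t => [n m k|t /andP[? ?]|t /andP[? ?] u /andP[? ?]] /=.
- exact: tent_unit.
- by apply/andP; split; lra.
- by rewrite le_max ge_max; apply/andP; split; [apply/orP; left|apply/andP].
Qed.

Lemma lval_unit_meas t : unit_meas (lval t).
Proof.
by split; [apply: (lipschitz_measurable rho_metric borel); exact: lval_lipschitz|exact: lval_unit].
Qed.

Lemma lval_bdd_meas t : bdd_meas (lval t).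
Proof. by apply: unit_meas_bdd; exact: lval_unit_meas. Qed.

Section approximation.
Context (mu nu : probability X R).

(** One term must be close to [f] in L1 of both laws at once: the difference of the two expectations
    of [f] is then controlled by that of a single member of the family. *)
Definition lapprox f := forall e : R, 0 < e -> exists t,
  expect mu (fun x => `|f x - lval t x|) <= e /\
  expect nu (fun x => `|f x - lval t x|) <= e.

Lemma bdd_meas_dist f g : bdd_meas f -> bdd_meas g -> bdd_meas (fun x => `|f x - g x|).
Proof. by move=> bf bg; apply: bdd_meas_norm; exact: bdd_measB. Qed.

(** Bounded convergence under both laws yields one index [n] good for both; a term close to [f_ n]
    then does the rest. *)
Lemma lapprox_lim f (f_ : nat -> X -> R) : (forall n, unit_meas (f_ n)) ->
  (forall n, lapprox (f_ n)) -> unit_meas f ->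
  (forall x, f_ n x @[n --> \oo] --> f x) -> lapprox f.
Proof.
move=> uf_ af_ uf ff e e0; have e20 := half_pos e0.
have bf := unit_meas_bdd uf; have bf_ n := unit_meas_bdd (uf_ n).
have cv (m : probability X R) :
    expect m (fun x => `|f x - f_ n x|) @[n --> \oo] --> 0.
  rewrite -(expect_cst m 0); apply: (@bounded_convergence _ _ _ m _ _ 1).
  - by move=> n; apply: (proj1 (bdd_meas_dist bf (bf_ n))).
  - move=> n x; rewrite normr_id ler_norml.
    have /andP[? ?] := uf.2 x; have /andP[? ?] := (uf_ n).2 x.
    by apply/andP; split; lra.
  - move=> x; rewrite -(@normr0 _ R) -(subrr (f x)).
    by apply: cvg_norm; apply: cvgB; [exact: cvg_cst|exact: ff].
have /cvgr0Pnorm_le/(_ _ e20) h1 := cv mu; have /cvgr0Pnorm_le/(_ _ e20) h2 := cv nu.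
have [n [hm hn]] := filter_ex (filterI h1 h2).
have [t [tm tn]] := af_ n _ e20.
exists t.
have tri (m : probability X R) : expect m (fun x => `|f x - lval t x|) <=
    expect m (fun x => `|f x - f_ n x|) + expect m (fun x => `|f_ n x - lval t x|).
  have bt := lval_bdd_meas t.
  rewrite -expectD; [|exact: bdd_meas_dist..]; apply: le_expect.
  - exact: bdd_meas_dist.
  - by apply: bdd_measD; exact: bdd_meas_dist.
  - by move=> x; exact: ler_distD.
split; apply: le_trans (tri _) _.
  by have := ler_norm (expect mu (fun x => `|f x - f_ n x|)); lra.
by have := ler_norm (expect nu (fun x => `|f x - f_ n x|)); lra.
Qed.

Lemma lapprox_compl f : lapprox f -> lapprox (fun x => 1 - f x).
Proof.
move=> af e e0; have [t [h1 h2]] := af e e0; exists (Compl t) => /=.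
have -> : (fun x => `|1 - f x - (1 - lval t x)|) = (fun x => `|f x - lval t x|).
  by apply/funext => x; rewrite opprB addrC addrA subrK distrC.
by [].
Qed.

Lemma lapprox_max f g : unit_meas f -> unit_meas g -> lapprox f -> lapprox g ->
  lapprox (fun x => Num.max (f x) (g x)).
Proof.
move=> uf ug af ag e e0; have e20 := half_pos e0.
have bf := unit_meas_bdd uf; have bg := unit_meas_bdd ug.
have [t [t1 t2]] := af _ e20; have [u [u1 u2]] := ag _ e20.
exists (Join t u).
have bt := lval_bdd_meas t; have bu := lval_bdd_meas u.
have umax : unit_meas (fun x => Num.max (f x) (g x)).
  split; first exact: measurable_maxr uf.1 ug.1.
  move=> x; have /andP[? ?] := uf.2 x; have /andP[? ?] := ug.2 x.
  by rewrite le_max ge_max; apply/andP; split; [apply/orP; left|apply/andP].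
have tri (m : probability X R) :
    expect m (fun x => `|Num.max (f x) (g x) - lval (Join t u) x|) <=
    expect m (fun x => `|f x - lval t x|) + expect m (fun x => `|g x - lval u x|).
  rewrite -expectD; [|exact: bdd_meas_dist..]; apply: le_expect.
  - by apply: bdd_meas_dist; [exact: unit_meas_bdd|exact: lval_bdd_meas].
  - by apply: bdd_measD; exact: bdd_meas_dist.
  - by move=> x; exact: ler_dist_max.
by split; apply: le_trans (tri _) _; lra.
Qed.

Definition lapprox_set : set (set X) := [set A | measurable A /\ lapprox (\1_A)].

Lemma lapprox_set0 : lapprox_set set0.
Proof.
split; first exact: measurable0.
move=> e e0; exists (Tent 0 0 0).
have -> : (fun x => `|\1_set0 x - lval (Tent 0 0 0) x|) = cst (0 : R).
  apply/funext => x; rewrite indic0 /= /tent mul0r.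
  by rewrite (_ : Num.min _ _ = 0) ?subrr ?normr0//; apply/min_idPr; exact: ler01.
by rewrite !expect_cst; split; exact: ltW.
Qed.

Lemma lapprox_setC A : lapprox_set A -> lapprox_set (~` A).
Proof.
move=> [mA aA]; split; first exact: measurableC.
rewrite (_ : \1_(~` A) = fun x => 1 - \1_A x); first exact: lapprox_compl.
by apply/funext => x; rewrite !indicE in_setC; case: (x \in A); rewrite /= ?subrr ?subr0.
Qed.

Lemma lapprox_setU A B : lapprox_set A -> lapprox_set B -> lapprox_set (A `|` B).
Proof.
move=> [mA aA] [mB aB]; split; first exact: measurableU.
rewrite (_ : \1_(A `|` B) = fun x => Num.max (\1_A x) (\1_B x)).
  by apply: lapprox_max => //; exact: unit_meas_indic.
apply/funext => x; rewrite !indicE in_setU.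
case: (x \in A); case: (x \in B) => /=; rewrite ?maxxx//.
  by apply/esym/max_idPl; exact: ler01.
by apply/esym/max_idPr; exact: ler01.
Qed.

Lemma lapprox_bigcup (F : nat -> set X) : (forall i, lapprox_set (F i)) ->
  lapprox_set (\bigcup_i F i).
Proof.
move=> aF; have mF i := (aF i).1.
have aU n : lapprox_set (\big[setU/set0]_(i < n) F i).
  elim: n => [|n IH]; first by rewrite big_ord0; exact: lapprox_set0.
  by rewrite big_ord_recr; exact: lapprox_setU.
have mUF : measurable (\bigcup_i F i) by exact: bigcupT_measurable.
split => //.
apply: (@lapprox_lim _ (fun n => \1_(\big[setU/set0]_(i < n) F i))).
- by move=> n; apply: unit_meas_indic; exact: (aU n).1.
- by move=> n; exact: (aU n).2.
- exact: unit_meas_indic.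
- move=> x; apply: cvg_near_cst; rewrite indicE.
  have [|xF] := boolP (x \in \bigcup_i F i).
    rewrite inE => -[i _ Fix]; exists i.+1 => // n /= ltin.
    rewrite indicE mem_set//; rewrite -bigcup_mkord; exists i => //.
  apply: nearW => n; rewrite indicE memNset//= -bigcup_mkord => -[i _ Fix].
  by move/negP: xF; apply; rewrite inE; exists i.
Qed.

Lemma lapprox_ball n m : lapprox_set (mk_rball rho (s n) m.+1%:R^-1).
Proof.
split; first exact: measurable_rball.
apply: (@lapprox_lim _ (fun k => lval (Tent n m k))).
- by move=> k; exact: lval_unit_meas.
- move=> k e e0; exists (Tent n m k).
  rewrite (_ : (fun x => _) = cst 0); last by apply/funext => x; rewrite subrr normr0.
  by rewrite !expect_cst; split; exact: ltW.
- by apply: unit_meas_indic; exact: measurable_rball.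
- by move=> x; exact: tent_cvg_indic.
Qed.

(** By separability an open set is the countable union of the balls of radius 1/(m+1) around dense
    points that it contains, and such balls are limits of tents. *)
Lemma lapprox_open A : mk_rho_open rho A -> lapprox_set A.
Proof.
move=> oA.
pose C n m := if asbool (mk_rball rho (s n) m.+1%:R^-1 `<=` A)
  then mk_rball rho (s n) m.+1%:R^-1 else set0.
have -> : A = \bigcup_n \bigcup_m C n m.
  apply/seteqP; split => [x Ax|x [n _ [m _]]]; last first.
    by rewrite /C; case: asboolP => // h /h.
  (* As 1/(m+1) < r/2, a ball of that radius around a dense point that close to [x] contains [x] and
     stays within distance [r] of it. *)
  have [r r0 xr] := oA _ Ax; have [m hm] := exists_natSinv_lt (half_pos r0).
  have [n hn] := s_dense x (e := m.+1%:R^-1) ltac:(by rewrite invr_gt0).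
  exists n => //; exists m => //; rewrite /C; case: asboolP => [_|].
    by rewrite /mk_rball /= rho_sym.
  move=> nA; exfalso; apply: nA => y; rewrite /mk_rball /= => hy; apply: xr; rewrite /mk_rball /=.
  move: hm hn hy; set q := (m.+1%:R^-1 : R) => hm hn hy.
  by have := rho_tri rho_metric (s n) x y; lra.
apply: lapprox_bigcup => n; apply: lapprox_bigcup => m; rewrite /C.
by case: asboolP => _; [exact: lapprox_ball|exact: lapprox_set0].
Qed.

Lemma lapprox_measurable A : measurable A -> lapprox_set A.
Proof.
move=> /borel; apply: smallest_sub; last by move=> B; exact: lapprox_open.
split; first exact: lapprox_set0.
- by move=> B aB; rewrite setTD; exact: lapprox_setC.
- exact: lapprox_bigcup.
Qed.

End approximation.

Definition lipfun i := lval (lterm_nth i).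

(** By [measure_le_dtv] this dominates the differences on all measurable sets, so it is the total
    variation distance, normalized to at most 1. The countable supremum makes it measurable in the
    starting point. *)
Definition tvdist mu nu := sup (range (fun i => `|expect mu (lipfun i) - expect nu (lipfun i)|)).

Lemma lfun_unit_meas i : unit_meas (lipfun i). Proof. exact: lval_unit_meas. Qed.

Lemma lfun_diff_le1 mu nu i : `|expect mu (lipfun i) - expect nu (lipfun i)| <= 1.
Proof.
have /andP[? ?] := expect_unit mu (lfun_unit_meas i).
have /andP[? ?] := expect_unit nu (lfun_unit_meas i).
by rewrite ler_norml; apply/andP; split; lra.
Qed.

Lemma lfun_le_dtv mu nu i : `|expect mu (lipfun i) - expect nu (lipfun i)| <= tvdist mu nu.
Proof.
by apply: ub_le_sup; [exists 1 => _ [j _ <-]; exact: lfun_diff_le1|exists i].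
Qed.

Lemma dtv_le mu nu (b : R) :
  (forall i, `|expect mu (lipfun i) - expect nu (lipfun i)| <= b) -> tvdist mu nu <= b.
Proof.
move=> h; apply: ge_sup; last by move=> _ [i _ <-].
by exists (`|expect mu (lipfun 0) - expect nu (lipfun 0)|), 0%N.
Qed.

Lemma dtv_unit mu nu : 0 <= tvdist mu nu <= 1.
Proof.
rewrite [X in _ && X]dtv_le ?andbT; last by move=> i; exact: lfun_diff_le1.
exact: le_trans (normr_ge0 _) (lfun_le_dtv mu nu 0).
Qed.

Lemma dtv_sym mu nu : tvdist mu nu = tvdist nu mu.
Proof.
by apply/eqP; rewrite eq_le; apply/andP; split; apply: dtv_le => i; rewrite distrC;
  exact: lfun_le_dtv.
Qed.

Lemma dtv_tri nu mu la : tvdist mu la <= tvdist mu nu + tvdist nu la.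
Proof.
apply: dtv_le => i; apply: le_trans (ler_distD (expect nu (lipfun i)) _ _) _.
by apply: lerD; exact: lfun_le_dtv.
Qed.

(** Some term lies within e/2 of the indicator of [A] in L1 of both laws, and its two expectations
    differ by at most [tvdist mu nu]. *)
Lemma measure_le_dtv mu nu A : measurable A ->
  `|fine (mu A) - fine (nu A)| <= tvdist mu nu.
Proof.
move=> mA; apply/ler_addgt0Pr => e e0.
have [_ /(_ _ (half_pos e0)) [t [h1 h2]]] := lapprox_measurable mu nu mA.
have [i it] := lterm_nth_surj t; have := lfun_le_dtv mu nu i.
rewrite /lipfun it -!expect_indic// => h3.
have bA : bdd_meas (\1_A : X -> R) by exact: bdd_meas_indic.
have bt := lval_bdd_meas t.
have h (m : probability X R) : `|expect m (\1_A) - expect m (lval t)| <=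
    expect m (fun x => `|\1_A x - lval t x|).
  by rewrite -expectB//; apply: expect_norm; exact: bdd_measB.
have := h mu; have := h nu; move: h3; rewrite !ler_norml.
by move=> /andP[? ?] /andP[? ?] /andP[? ?]; apply/andP; split; lra.
Qed.

Lemma expect_le_dtv mu nu f : unit_meas f ->
  `|expect mu f - expect nu f| <= tvdist mu nu.
Proof. by apply: expect_close => B; exact: measure_le_dtv. Qed.

End determining_family.

(** * Asymptotic coalescence of the transition laws *)

Lemma le_of_natSinv {R : realType} (a b c : R) :
  (forall N : nat, a <= b + c * N.+1%:R^-1) -> a <= b.
Proof.
move=> h; apply/ler_addgt0Pr => e e0.
have c0 : 0 < `|c| + 1 by rewrite ltr_wpDl.
have [N hN] := exists_natSinv_lt (divr_gt0 e0 c0).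
apply: le_trans (h N) _; rewrite lerD2l.
move: hN; rewrite ltr_pdivlMr// => /ltW; apply: le_trans.
rewrite mulrC ler_wpM2l ?invr_ge0//.
by have := ler_norm c; lra.
Qed.

(** Let [w] be [b1] on [A] and [b2] off [A]. Since [h] is nonincreasing in [n], a bound reached at
    one index persists, so the positive part of [h n - w] tends to 0 pointwise and in mean; the mean
    of [w] is b2 - kappa(A) (b2 - b1). *)
Lemma noninc_mix {R : realType} {d : measure_display} {X : measurableType d}
    (kappa : probability X R) (h : nat -> X -> R) (A : set X) (b1 b2 p : R) :
  (forall n, unit_meas (h n)) -> (forall n m x, (n <= m)%N -> h m x <= h n x) ->
  measurable A -> b1 <= b2 -> p <= fine (kappa A) ->
  (forall x, A x -> forall e, 0 < e -> exists n, h n x <= b1 + e) ->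
  (forall x e, 0 < e -> exists n, h n x <= b2 + e) ->
  forall e, 0 < e -> exists n, expect kappa (h n) <= b2 - p * (b2 - b1) + e.
Proof.
move=> uh dh mA b12 pA h1 h2 e e0.
pose w x := b2 + (- (b2 - b1)) * \1_A x.
have bA : bdd_meas (\1_A : X -> R) by exact: bdd_meas_indic.
have bw : bdd_meas w by apply: bdd_measD; [exact: bdd_meas_cst|exact: bdd_measZ].
pose hp n x := Num.max 0 (h n x - w x).
have wb x : - (`|b1| + `|b2|) <= w x.
  have := ler_norm (- b1); have := ler_norm (- b2); rewrite !normrN.
  have := normr_ge0 b1; have := normr_ge0 b2.
  by rewrite /w indicE; case: (x \in A) => /=; rewrite ?mulr1 ?mulr0; lra.
have mhp n : measurable_fun setT (hp n).
  apply: measurable_maxr; first exact: measurable_cst.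
  by apply: measurable_funB; [exact: (uh n).1|exact: bw.1].
have hpb n x : `|hp n x| <= 1 + (`|b1| + `|b2|).
  rewrite ger0_norm ?le_max ?lexx// ge_max.
  have /andP[? ?] := (uh n).2 x; have := wb x.
  by have := normr_ge0 b1; have := normr_ge0 b2 => ? ? ?; apply/andP; split; lra.
have cv : expect kappa (hp n) @[n --> \oo] --> 0.
  rewrite -(expect_cst kappa 0).
  apply: (@bounded_convergence _ _ _ kappa hp _ (1 + (`|b1| + `|b2|))) => // x.
  apply/cvgrPdist_le => r r0.
  have [N hN] : exists N, h N x <= w x + r.
    rewrite /w indicE; have [|_] := boolP (x \in A).
      rewrite inE => Ax; have [N hN] := h1 x Ax r r0; exists N.
      by rewrite mulr1; lra.
    by have [N hN] := h2 x r r0; exists N; rewrite mulr0; lra.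
  exists N => // n /= Nn; rewrite sub0r normrN ger0_norm ?le_max ?lexx// ge_max.
  have := dh _ _ x Nn => ?; apply/andP; split; lra.
have /cvgr0Pnorm_le/(_ _ e0)/filter_ex[n hn] := cv.
exists n.
have bhp : bdd_meas (hp n) by split; [exact: mhp|exists (1 + (`|b1| + `|b2|)); exact: hpb].
apply: (@le_trans _ _ (expect kappa (fun x => w x + hp n x))).
  apply: le_expect; first exact: unit_meas_bdd.
    exact: bdd_measD.
  move=> x; have : h n x - w x <= hp n x by rewrite le_max lexx orbT.
  by lra.
rewrite expectD// /w expectD ?expect_cst ?expectZ ?expect_indic//; last 2 first.
  exact: bdd_meas_cst.
  exact: bdd_measZ.
have := ler_norm (expect kappa (hp n)).
have : p * (b2 - b1) <= (b2 - b1) * fine (kappa A).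
  by rewrite mulrC ler_wpM2l// subr_ge0.
by lra.
Qed.

Section semigroup.
Context {R : realType} {d : measure_display} {X : measurableType d}.
Context (rho : X -> X -> R) (rho_metric : mk_is_metric rho)
  (borel : mk_borel_of rho)
  (s : nat -> X) (s_dense : forall x (e : R), 0 < e -> exists n, rho x (s n) < e).
Context (K : R -> X -> probability X R).

(** What the Markov and Feller properties say about the laws at fixed times; coalescence and
    existence are argued from it without sample paths. *)
Record feller_semigroup : Prop := {
  kernel_meas : forall t B, 0 <= t -> measurable B ->
    measurable_fun setT (fun x => fine (K t x B)) ;
  kernel_CK : forall s t x B, 0 <= s -> 0 <= t -> measurable B ->
    fine (K (s + t) x B) = expect (K s x) (fun y => fine (K t y B)) ;
  kernel_feller : forall t f, 0 <= t -> mk_bounded_continuous rho f ->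
    forall x, mk_rho_continuous_at rho (fun y => expect (K t y) f) x }.

Context (KP : feller_semigroup).
Implicit Types (f g : X -> R) (t u : R) (mu nu la : probability X R).

Local Notation dtv := (tvdist rho s).
Local Notation lfun := (lipfun rho s).

Lemma kernel_unit_meas t B : 0 <= t -> measurable B ->
  unit_meas (fun x => fine (K t x B)).
Proof.
move=> t0 mB; split; first exact: kernel_meas.
by move=> x; have := expect_unit (K t x) (unit_meas_indic mB); rewrite expect_indic.
Qed.

Lemma semigroup_unit_meas t f : 0 <= t -> unit_meas f ->
  unit_meas (fun x => expect (K t x) f).
Proof.
move=> t0 uf; split; last by move=> x; exact: expect_unit.
apply: (@measurable_fun_cvg _ _ _ _ (fun N x => expect (K t x) (stair N.+1 f))).
  move=> N; under eq_fun do rewrite (expect_stair _ _ uf.1).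
  apply: measurable_funM; first exact: measurable_cst.
  apply: measurable_sum => k; apply: kernel_meas => //.
  by apply: measurable_stair_level; exact: uf.1.
move=> x _; apply/cvgrPdist_le => e e0.
have [N hN] := exists_natSinv_lt e0; exists N => // n /= Nn.
apply: le_trans (unit_meas_stair_dist _ _ uf) _; apply: le_trans (ltW hN).
by rewrite lef_pV2 ?posrE// ler_nat.
Qed.

(** The identity on sets gives it for [stair], and each side moves by at most 1/(N+1) when [stair]
    replaces [f]: hence the constant 2. *)
Lemma expect_kernel_comp kappa mu u f : 0 <= u ->
  (forall B, measurable B -> fine (mu B) = expect kappa (fun y => fine (K u y B))) ->
  unit_meas f -> expect mu f = expect kappa (fun y => expect (K u y) f).
Proof.
move=> u0 muE uf; apply/eqP; rewrite -subr_eq0 -normr_le0.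
apply: (@le_of_natSinv _ _ _ 2) => N; rewrite add0r.
have mlev k := measurable_stair_level N.+1 k uf.1.
have h1 := unit_meas_stair_dist mu N uf.
pose lev k y := fine (K u y (stair_level N.+1 f k)).
have blev k : bdd_meas (lev k) by apply: unit_meas_bdd; exact: kernel_unit_meas.
have stairE : (fun y => expect (K u y) (stair N.+1 f)) =
    (fun y => N.+1%:R^-1 * \sum_(k < N.+1) lev k y).
  by apply/funext => y; rewrite (expect_stair _ _ uf.1).
have e : expect mu (stair N.+1 f) =
    expect kappa (fun y => expect (K u y) (stair N.+1 f)).
  rewrite (expect_stair _ _ uf.1) stairE expectZ; last exact: bdd_meas_sum.
  rewrite expect_sum//.
  by congr (_ * _); apply: eq_bigr => k _; exact: muE.
have h2 : `|expect kappa (fun y => expect (K u y) f) -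
    expect kappa (fun y => expect (K u y) (stair N.+1 f))| <= N.+1%:R^-1.
  apply: expect_dist; first by apply: unit_meas_bdd; exact: semigroup_unit_meas.
    by rewrite stairE; apply: bdd_measZ; exact: bdd_meas_sum.
  by move=> y; exact: unit_meas_stair_dist.
rewrite e in h1; move: h1 h2; set q := (N.+1%:R^-1 : R).
rewrite !ler_norml => /andP[? ?] /andP[? ?]; apply/andP; split; lra.
Qed.

Lemma semigroup_CK t u f x : 0 <= t -> 0 <= u -> unit_meas f ->
  expect (K (t + u) x) f = expect (K t x) (fun y => expect (K u y) f).
Proof.
by move=> t0 u0; apply: expect_kernel_comp => // B mB; exact: kernel_CK.
Qed.

Lemma dtv_kernel_unit_meas t la : 0 <= t -> unit_meas (fun x => dtv (K t x) la).
Proof.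
move=> t0; split; last by move=> x; exact: dtv_unit.
pose h i x := `|expect (K t x) (lfun i) - expect la (lfun i)|.
rewrite (_ : (fun x => _) = (fun x => sups (h ^~ x) 0)); last first.
  by apply/funext => x; rewrite /tvdist /sups /sdrop /=; congr sup;
    apply/seteqP; split => _ [i _ <-]; exists i.
apply: measurable_fun_sups => [x _|i].
  by exists 1 => _ [i _ <-]; exact: lfun_diff_le1.
apply: measurableT_comp => //; apply: measurable_funB; last exact: measurable_cst.
by have [] := semigroup_unit_meas t0 (lfun_unit_meas rho_metric borel s i).
Qed.

(** Moving the time [r] onto the test function turns [lipfun] into a measurable function with values
    in [0,1] that is in general not Lipschitz; [expect_le_dtv] covers it because [tvdist] is a total
    variation distance. *)
Lemma dtv_contract t u r x y : 0 <= t -> 0 <= u -> 0 <= r ->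
  dtv (K (t + r) x) (K (u + r) y) <= dtv (K t x) (K u y).
Proof.
move=> t0 u0 r0; apply: dtv_le => i; have ui := lfun_unit_meas rho_metric borel s i.
rewrite !semigroup_CK//; apply: (expect_le_dtv rho_metric borel s_dense).
exact: semigroup_unit_meas.
Qed.

(** Convexity of the distance in its first argument, [mu] being the mixture of the laws [K t x]
    under [kappa]. *)
Lemma dtv_mix t kappa mu la : 0 <= t ->
  (forall f, unit_meas f -> expect mu f = expect kappa (fun x => expect (K t x) f)) ->
  dtv mu la <= expect kappa (fun x => dtv (K t x) la).
Proof.
move=> t0 h; apply: dtv_le => i; have ui := lfun_unit_meas rho_metric borel s i.
have bK : bdd_meas (fun x => expect (K t x) (lfun i)).
  by apply: unit_meas_bdd; exact: semigroup_unit_meas.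
rewrite (h _ ui) -(expect_cst kappa (expect la (lfun i))) -expectB//; last exact: bdd_meas_cst.
apply: le_trans (expect_norm _ _) _; first by apply: bdd_measB => //; exact: bdd_meas_cst.
apply: le_expect.
- by apply: bdd_meas_dist => //; exact: bdd_meas_cst.
- by apply: unit_meas_bdd; exact: dtv_kernel_unit_meas.
- by move=> x; exact: lfun_le_dtv.
Qed.

Definition nat_kernel (n : nat) := K n%:R.

Local Notation natK := nat_kernel.

(** The two times may differ provided they advance by the same amount; [asymp_dist_step] compares
    [natK m x'] with [natK (n + m) y]. *)
Lemma natK_le n m k l x y : (n <= m)%N -> (m - n = l - k)%N -> (k <= l)%N ->
  dtv (natK m x) (natK l y) <= dtv (natK n x) (natK k y).
Proof.
move=> nm e kl; rewrite /nat_kernel -(subnK nm) -(subnK kl) !natrD -e.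
by rewrite ![(m - n)%:R + _]addrC; exact: dtv_contract.
Qed.

Lemma natK_mono n m x y : (n <= m)%N ->
  dtv (natK m x) (natK m y) <= dtv (natK n x) (natK n y).
Proof. by move=> nm; exact: natK_le. Qed.

Lemma natK_mix n m x la :
  dtv (natK (n + m) x) la <= expect (natK n x) (fun y => dtv (natK m y) la).
Proof. by apply: dtv_mix => // f uf; rewrite /nat_kernel natrD semigroup_CK. Qed.

Lemma natK_dtv_unit_meas n la : unit_meas (fun x => dtv (natK n x) la).
Proof. exact: dtv_kernel_unit_meas. Qed.

(** The distance is nonincreasing in [n], so one [n] for each [e] says that its limit is at most
    [b]. The same convention is used in [asymp_cont]. *)
Definition asymp_dist_le (b : R) := forall x y e, 0 < e ->
  exists n, dtv (natK n x) (natK n y) <= b + e.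

Context (z : X).

Definition asymp_cont := forall e, 0 < e -> exists2 dl, 0 < dl & forall x,
  rho z x < dl -> exists n, dtv (natK n x) (natK n z) <= e.

Definition asymp_reach := forall r, 0 < r -> exists2 p, 0 < p & forall x,
  exists N, forall n, (N <= n)%N -> p <= fine (natK n x (mk_rball rho z r)).

Context (z_cont : asymp_cont) (z_reach : asymp_reach).

(** After a waiting time both laws give mass at least [p] to a ball in which any two points end up
    at distance at most 2 eps. Averaging over one law, then over the other, gains a factor [p] each
    time. The product depends on [eps] but not on [b], as [asymp_dist0] requires. *)
Lemma asymp_dist_step eps : 0 < eps -> exists2 p, 0 < p <= 1 &
  forall b, 2 * eps <= b -> asymp_dist_le b -> asymp_dist_le (b - p * (b - 2 * eps)).
Proof.
move=> e0; have [dl dl0 hdl] := z_cont e0; have [p p0 hp] := z_reach dl0.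
set U := mk_rball rho z dl in hp.
have mU : measurable U by exact: measurable_rball.
have p1 : p <= 1.
  have [N /(_ N (leqnn N)) hN] := hp z; apply: le_trans hN _.
  by have /andP[] := expect_unit (natK N z) (unit_meas_indic mU); rewrite expect_indic.
exists (p * p); first by rewrite mulr_gt0//= mulr_ile1// ltW.
move=> b eb gb x y e ee0.
have [N1 hN1] := hp x; have [N2 hN2] := hp y; pose n := maxn N1 N2.
have px := hN1 n (leq_maxl _ _); have py := hN2 n (leq_maxr _ _).
(* Both points are compared with [z], and monotonicity brings the two comparisons to a common
   time. *)
have close x' y' : U x' -> U y' -> exists m, dtv (natK m y') (natK m x') <= 2 * eps.
  move=> /hdl[m1 hm1] /hdl[m2 hm2]; exists (maxn m1 m2).
  apply: le_trans (dtv_tri rho_metric borel s (natK (maxn m1 m2) z) _ _) _.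
  have := le_trans (natK_mono x' z (leq_maxl m1 m2)) hm1.
  have := le_trans (natK_mono y' z (leq_maxr m1 m2)) hm2.
  by rewrite (dtv_sym rho_metric borel s (natK _ z)); lra.
(* Half-averaged distance: the second law has already made its first [n] steps, and [Jmix] bounds it
   by an average over the position [y'] reached then. *)
pose J m x' := dtv (natK m x') (natK (n + m) y).
have Jmix x' q c : (forall e, 0 < e -> exists m, expect (natK n y)
      (fun y' => dtv (natK m y') (natK m x')) <= q + e) -> 0 < c ->
    exists m, J m x' <= q + c.
  move=> h c0; have [m hm] := h c c0; exists m; apply: le_trans hm.
  by rewrite /J (dtv_sym rho_metric borel s); exact: natK_mix.
(* Outer averaging, with level b1 = b - p (b - 2 eps) on [U], supplied by the inner averaging over
   [y'], and level [b] elsewhere: the gain is p (b - b1) = p^2 (b - 2 eps). *)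
have [m hm] : exists m, expect (natK n x) (J m) <=
    b - p * (b - (b - p * (b - 2 * eps))) + e.
  apply: (@noninc_mix _ _ _ _ _ U) => //.
  - by move=> m; exact: natK_dtv_unit_meas.
  - move=> m1 m2 x' m12; apply: natK_le => //; last by rewrite leq_add2l.
    by rewrite subnDl.
  - by rewrite lerBlDr lerDl mulr_ge0 ?subr_ge0// ltW.
  - move=> x' Ux' c c0; apply: Jmix => // c' c'0.
    apply: (@noninc_mix _ _ _ _ _ U) => //.
    + by move=> m; exact: natK_dtv_unit_meas.
    + by move=> m1 m2 y' m12; exact: natK_mono.
    + move=> y' Uy' r r0; have [m hm] := close _ _ Ux' Uy'.
      by exists m; apply: le_trans hm _; rewrite lerDl ltW.
    + by move=> y' r r0; exact: gb.
  (* For a general [x'] the inner averaging gains nothing: both levels are [b]. *)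
  - move=> x' c c0; apply: Jmix => // c' c'0.
    have := @noninc_mix _ _ _ (natK n y) (fun m y' => dtv (natK m y') (natK m x')) U b b p.
    rewrite subrr mulr0 subr0; apply => //.
    + by move=> m; exact: natK_dtv_unit_meas.
    + by move=> m1 m2 y' m12; exact: natK_mono.
    + by move=> y' _ r r0; exact: gb.
    + by move=> y' r r0; exact: gb.
exists (n + m)%N; apply: le_trans (natK_mix n m x _) _; apply: le_trans hm _.
by rewrite (_ : b - (b - p * (b - 2 * eps)) = p * (b - 2 * eps)) ?mulrA//; ring.
Qed.

(** The infimum of the admissible bounds is itself admissible, and [asymp_dist_step] would lower it
    if it were positive. *)
Lemma asymp_dist0 : asymp_dist_le 0.
Proof.
pose G := [set b : R | 0 <= b /\ asymp_dist_le b].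
have G1 : G 1.
  split; first exact: ler01.
  move=> x y e e0; exists 0%N; have /andP[_ h] := dtv_unit rho_metric borel s (natK 0 x) (natK 0 y).
  by apply: le_trans h _; rewrite lerDl ltW.
have Glb : has_lbound G by exists 0 => b [].
have Ginf : has_inf G by split; [exists 1|].
have S0 : 0 <= inf G by apply: lb_le_inf; [exists 1|move=> b []].
have SG : asymp_dist_le (inf G).
  move=> x y e e0; have [b [b0 gb] bS] := inf_adherent (half_pos e0) Ginf.
  have [n hn] := gb x y _ (half_pos e0); exists n.
  by apply: le_trans hn _; lra.
have [S1|S1] := leP (inf G) 0.
  by have <- : inf G = 0 by apply/eqP; rewrite eq_le S1 S0.
(* With eps = inf G / 4 the bound drops by p (inf G) / 2 > 0, and p <= 1 keeps the new bound
   nonnegative, hence in [G]. *)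
have e0 : 0 < inf G / 4 by rewrite divr_gt0.
have [p /andP[p0 p1] hp] := asymp_dist_step e0.
have := hp (inf G) ltac:(lra) SG.
set S' := _ - _ => gS'.
have pS : p * (inf G - 2 * (inf G / 4)) <= 1 * (inf G - 2 * (inf G / 4)).
  by rewrite ler_wpM2r//; lra.
have pS0 : 0 < p * (inf G - 2 * (inf G / 4)) by rewrite mulr_gt0//; lra.
have : inf G <= S'.
  by apply: ge_inf => //; split => //; rewrite /S'; lra.
by rewrite /S'; lra.
Qed.

End semigroup.

(** * Largest countably additive minorant, generalized limits, Baire category *)

Section largest_measure_minorant.
Context {R : realType} {d : measure_display} {X : measurableType d}.
Context (nu : set X -> R) (nu0 : nu set0 = 0) (nu_ge0 : forall A, 0 <= nu A)
  (nu_add : forall A B, measurable A -> measurable B ->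
    nu B = nu (B `&` A) + nu (B `&` ~` A)).

Lemma content_le A B : measurable A -> measurable B -> A `<=` B -> nu A <= nu B.
Proof.
by move=> mA mB AB; rewrite (nu_add mA mB) setIC (setIidl AB) lerDl.
Qed.

Lemma content_bigsetU (F : nat -> set X) n : (forall i, measurable (F i)) ->
  nu (\big[setU/set0]_(i < n) F i) <= \sum_(i < n) nu (F i).
Proof.
move=> mF; elim: n => [|n IH]; first by rewrite !big_ord0 nu0.
have mU : measurable (\big[setU/set0]_(i < n) F i) by exact: bigsetU_measurable.
rewrite !big_ord_recr /= (nu_add (mF n) (measurableU _ _ mU (mF n))).
rewrite [leRHS]addrC; apply: lerD.
  by apply: content_le => //; apply: measurableI => //; exact: measurableU.
apply: le_trans IH; apply: content_le => //.
  by apply: measurableI; [exact: measurableU|exact: measurableC].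
by move=> x [[]].
Qed.

Let nuE (A : set X) : \bar R := (nu A)%:E.

Let nuE0 : nuE set0 = 0%E. Proof. by rewrite /nuE nu0. Qed.

Let nuE_ge0 A : (0 <= nuE A)%E. Proof. by rewrite lee_fin. Qed.

(** A measurable cover of [Y] cut by [A] and by its complement covers the two pieces of [Y], and
    finite additivity preserves the total content. *)
Lemma measurable_caratheodory_mu_ext A : measurable A ->
  caratheodory_measurable (mu_ext nuE) A.
Proof.
move=> mA.
pose om : {outer_measure set X -> \bar R} := HB.pack (mu_ext nuE)
  (isOuterMeasure.Build R X (mu_ext nuE) (mu_ext0 nuE0 nuE_ge0) (mu_ext_ge0 nuE_ge0)
    (le_mu_ext nuE) (mu_ext_sigma_subadditive nuE_ge0)).
apply: (@le_caratheodory_measurable _ _ om) => Y.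
apply: le_ereal_inf_tmp => _ [F [mF YF] <-].
have mI i : measurable (F i `&` A) by exact: measurableI.
have mIC i : measurable (F i `&` ~` A) by apply: measurableI => //; exact: measurableC.
rewrite (eq_eseriesr (g := fun i => nuE (F i `&` A) + nuE (F i `&` ~` A))%E); last first.
  by move=> i _; rewrite /nuE -EFinD -nu_add.
rewrite nneseriesD; [|by move=> *; exact: nuE_ge0..].
apply: leeD; apply: ereal_inf_lbound.
  by exists (fun i => F i `&` A) => //; split => // x [/YF[i _ Fix] Ax]; exists i.
by exists (fun i => F i `&` ~` A) => //; split => // x [/YF[i _ Fix] Ax]; exists i.
Qed.

(** [pi] is the outer measure built from countable measurable covers. Maximality is stated for a set
    function [g] at one set [A], from domination by [nu] and continuity along covers of [A]; thus
    [g] may be negative somewhere, as beta (K k z - 1/2) is. *)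
Lemma largest_measure_minorant : exists pi : {measure set X -> \bar R},
  (forall A, measurable A -> (pi A <= (nu A)%:E)%E) /\
  forall (g : set X -> R) A, measurable A -> (forall B, measurable B -> g B <= nu B) ->
    (forall F : nat -> set X, (forall i, measurable (F i)) -> A `<=` \bigcup_i F i ->
      g (A `&` \big[setU/set0]_(i < n) F i) @[n --> \oo] --> g A) ->
    ((g A)%:E <= pi A)%E.
Proof.
pose om : {outer_measure set X -> \bar R} := HB.pack (mu_ext nuE)
  (isOuterMeasure.Build R X (mu_ext nuE) (mu_ext0 nuE0 nuE_ge0) (mu_ext_ge0 nuE_ge0)
    (le_mu_ext nuE) (mu_ext_sigma_subadditive nuE_ge0)).
have sa : semi_sigma_additive (mu_ext nuE : set X -> \bar R).
  move=> F mF tF mUF.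
  apply: (@caratheodory_measure_sigma_additive _ _ om) => //.
    by move=> i; exact: measurable_caratheodory_mu_ext.
  exact: measurable_caratheodory_mu_ext.
pose pi : {measure set X -> \bar R} := HB.pack (mu_ext nuE)
  (isMeasure.Build d X R (mu_ext nuE) (mu_ext0 nuE0 nuE_ge0) (mu_ext_ge0 nuE_ge0) sa).
exists pi; split.
  (* The cover consisting of [A] followed by empty sets. *)
  move=> A mA; apply: ereal_inf_lbound; exists (fun n => if n is 0%N then A else set0).
    by split=> [[]// _|t Xt]; exists 0%N.
  apply/cvg_lim => //; rewrite -cvg_shiftS.
  rewrite (_ : [sequence _]_n = cst (nuE A)); first exact: cvg_cst.
  by rewrite funeqE => n /=; rewrite big_nat_recl//= big1 ?adde0.
move=> g A mA gnu gF; apply: le_ereal_inf_tmp => _ [F [mF AF] <-].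
have mU n : measurable (\big[setU/set0]_(i < n) F i) by exact: bigsetU_measurable.
have h : (g (A `&` \big[setU/set0]_(i < n) F i))%:E @[n --> \oo] --> (g A)%:E.
  by apply: cvg_EFin; [exact: nearW|exact: gF].
apply: (cvge_to_le h); near=> n; apply: le_trans (nneseries_lim_ge n (fun _ _ _ => nuE_ge0 _)).
rewrite big_mkord /nuE sumEFin lee_fin.
apply: le_trans (gnu _ _) _; first exact: measurableI.
apply: le_trans (content_bigsetU n mF).
by apply: content_le => //; exact: measurableI.
Unshelve. all: by end_near.
Qed.

End largest_measure_minorant.

Lemma fmap_ultra (T S : Type) (u : T -> S) (U : set_system T) :
  UltraFilter U -> UltraFilter (u @ U).
Proof.
move=> UU; split; first exact: fmap_proper_filter.
move=> G GP UG; apply/seteqP; split => // A GA.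
have [//|nA] := in_ultra_setVsetC (u @^-1` A) UU.
have GnA : G (~` A) by exact: UG.
by have [x []] := filter_ex (filterI GA GnA).
Qed.

Section generalized_limit.
Context {R : realType}.

Definition seq_bdd (u : nat -> R) := exists M, forall n, `|u n| <= M.

(** Limit along an ultrafilter finer than [\oo]: bounded sequences converge along it by compactness
    of segments. Invariance of the functional built from it comes from coalescence, in
    [limf_invariant]. *)
Lemma generalized_limit : exists L : (nat -> R) -> R,
  [/\ forall u v, seq_bdd u -> seq_bdd v -> L (fun n => u n + v n) = L u + L v,
      forall c u, seq_bdd u -> L (fun n => c * u n) = c * L u,
      forall u l, u n @[n --> \oo] --> l -> L u = l &
      forall u v, seq_bdd u -> seq_bdd v ->
        (\forall n \near \oo, u n <= v n) -> L u <= L v].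
Proof.
have [U [UU ooU]] := @ultraFilterLemma nat \oo _.
have cv u : seq_bdd u -> cvg (u @ U).
  move=> [M uM]; have := @segment_compact R (- M) M; rewrite compact_ultra.
  move=> /(_ (u @ U) (fmap_ultra u UU)) [].
    by apply: (@filterE _ U) => n; rewrite /= in_itv /= -ler_norml.
  by move=> l [_ ul]; apply/cvg_ex; exists l.
exists (fun u => lim (u @ U)); split.
- by move=> u v bu bv; apply/cvg_lim => //; apply: cvgD; exact: cv.
- by move=> c u bu; apply/cvg_lim => //; apply: cvgMr; exact: cv.
- by move=> u l ul; apply/cvg_lim => //; apply: cvg_trans ul; exact: cvg_app.
- move=> u v bu bv uv; apply: ler_lim; [exact: cv|exact: cv|].
  exact: ooU.
Qed.

End generalized_limit.

Section baire.
Context {R : realType} {d : measure_display} {X : measurableType d}.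
Context (rho : X -> X -> R) (rho_metric : mk_is_metric rho) (rho_compl : mk_rho_complete rho).

(** Otherwise every ball centred in [G] contains points of [G] outside each [A k], and nested balls
    shrink to a point of [G] lying in no [A k]. *)
Lemma baire_closed_cover (G : set X) (A : nat -> set X) (z : X) : G z ->
  mk_rho_open rho (~` G) -> (forall k, mk_rho_open rho (~` A k)) ->
  G `<=` \bigcup_k A k ->
  exists y r k, [/\ G y, 0 < r & G `&` mk_rball rho y r `<=` A k].
Proof.
move=> Gz oG oA GA; apply: contrapT => nbaire.
(* The implication makes the step total, so that [choice] applies. The factor 2 leaves room for the
   limit point, which is located only within twice the radius. *)
have step (k : nat) (p : X * R) : exists p' : X * R, G p.1 /\ 0 < p.2 ->
   [/\ G p'.1, 0 < p'.2 <= k.+1%:R^-1, rho p.1 p'.1 + p'.2 < p.2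
     & forall w, rho p'.1 w < 2 * p'.2 -> ~ A k w].
  have [[Gp p0]|] := pselect (G p.1 /\ 0 < p.2); last by exists p.
  have [y [[Gy yp] nAy]] : exists y, (G `&` mk_rball rho p.1 p.2) y /\ ~ A k y.
    apply: contrapT => h; apply: nbaire; exists p.1, p.2, k; split => // y hy.
    by apply: contrapT => nAy; apply: h; exists y.
  have [r r0 yr] := oA k y nAy.
  have k0 : (0 : R) < k.+1%:R^-1 by rewrite invr_gt0.
  have yp' : 0 < p.2 - rho p.1 y by rewrite subr_gt0.
  pose r' := Num.min (k.+1%:R^-1) (Num.min (r / 2) ((p.2 - rho p.1 y) / 2)).
  exists (y, r') => _ /=; split => //.
  - by rewrite ge_min lexx /= !lt_min k0 !divr_gt0.
  - have : r' <= (p.2 - rho p.1 y) / 2 by rewrite /r' !ge_min lexx !orbT.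
    by lra.
  - move=> w hw; apply: yr; rewrite /mk_rball /=; apply: lt_le_trans hw _.
    have : r' <= r / 2 by rewrite /r' !ge_min lexx !orbT.
    by lra.
pose f k := projT1 (choice (step k)).
have hf k q := projT2 (choice (step k)) q.
pose p := fix p n := if n is n'.+1 then f n' (p n') else (z, 1).
have pG n : G (p n).1 /\ 0 < (p n).2.
  elim: n => [|n IH] /=; first by split.
  by have [? /andP[? _] _ _] := hf n (p n) IH.
have pS n : rho (p n).1 (p n.+1).1 + (p n.+1).2 < (p n).2.
  by have [] := hf n (p n) (pG n).
have pk n : (p n.+1).2 <= n.+1%:R^-1.
  by have [_ /andP[_ ?]] := hf n (p n) (pG n).
have nest n k : rho (p n).1 (p (n + k)%N).1 + (p (n + k)%N).2 <= (p n).2.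
  elim: k => [|k IH]; first by rewrite addn0 (rho_xx rho_metric) add0r.
  apply: le_trans IH; rewrite addnS.
  have := rho_tri rho_metric (p (n + k)%N).1 (p n).1 (p (n + k).+1).1.
  by have := pS (n + k)%N; lra.
have near_ n m : (n <= m)%N -> rho (p n).1 (p m).1 < (p n).2.
  move=> nm; rewrite -(subnKC nm); have := nest n (m - n)%N.
  by have := (pG (n + (m - n))%N).2; lra.
have [l hl] : exists l, forall e, 0 < e -> exists N, forall n, (N <= n)%N ->
    rho l (p n).1 < e.
  apply: rho_compl => e e0; have [N hN] := exists_natSinv_lt (half_pos e0).
  exists N.+1 => m n Nm Nn; have := near_ _ _ Nm; have := near_ _ _ Nn.
  have := rho_tri rho_metric (p N.+1).1 (p m).1 (p n).1; have := pk N.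
  rewrite (rho_sym rho_metric (p m).1 (p N.+1).1); move: hN.
  by set q := (N.+1%:R^-1 : R); lra.
have Gl : G l.
  apply: contrapT => nGl; have [r r0 lr] := oG l nGl.
  have [N /(_ N (leqnn N)) hN] := hl r r0.
  exact: lr _ hN (pG N).1.
have [k _ Akl] := GA l Gl.
have [_ _ _ /(_ l)] := hf k (p k) (pG k); apply => //.
rewrite -/(p k.+1).
have [N hN] := hl _ (pG k.+1).2.
have := hN _ (leq_maxl N k.+1); have := near_ _ _ (leq_maxr N k.+1).
have := rho_tri rho_metric (p (maxn N k.+1)).1 (p k.+1).1 l.
by rewrite (rho_sym rho_metric l); lra.
Qed.

End baire.

(** * Existence and uniqueness of the invariant probability *)

Section invariant_measure.
Context {R : realType} {d : measure_display} {X : measurableType d}.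
Context (rho : X -> X -> R) (rho_metric : mk_is_metric rho)
  (rho_compl : mk_rho_complete rho) (borel : mk_borel_of rho)
  (s : nat -> X) (s_dense : forall x (e : R), 0 < e -> exists n, rho x (s n) < e).
Context (K : R -> X -> probability X R) (KP : feller_semigroup rho K).
Context (K_dist0 : asymp_dist_le rho s K 0).
Implicit Types (f g : X -> R) (t u : R) (mu nu la : probability X R).

Local Notation dtv := (tvdist rho s).
Local Notation lfun := (lipfun rho s).
Local Notation natK := (nat_kernel K).

Lemma expect_dtv_small kappa x (e : R) : 0 < e -> exists N, forall m, (N <= m)%N ->
  expect kappa (fun y => dtv (natK m y) (natK m x)) <= e.
Proof.
move=> e0.
have [n hn] : exists n, expect kappa (fun y => dtv (natK n y) (natK n x)) <=
    0 - 0 * (0 - 0) + e.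
  (* Taking the empty set and p = 0 leaves plain convergence of the mean to 0. *)
  apply: (@noninc_mix _ _ _ kappa (fun m y => dtv (natK m y) (natK m x)) set0) => //.
  - by move=> m; exact: (natK_dtv_unit_meas rho_metric borel s KP).
  - by move=> m1 m2 y m12; exact: (natK_mono rho_metric borel s_dense KP).
  - by rewrite measure0.
  - by move=> y r r0; exact: K_dist0.
rewrite mul0r subrr add0r in hn; exists n => m nm.
apply: le_trans hn; apply: le_expect.
- by apply: unit_meas_bdd; exact: (natK_dtv_unit_meas rho_metric borel s KP).
- by apply: unit_meas_bdd; exact: (natK_dtv_unit_meas rho_metric borel s KP).
- by move=> y; exact: (natK_mono rho_metric borel s_dense KP).
Qed.

(** Supplies the continuity along covers that [largest_measure_minorant] asks for. *)
Lemma fine_cover_cvg mu A (F : nat -> set X) : measurable A ->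
  (forall i, measurable (F i)) -> A `<=` \bigcup_i F i ->
  fine (mu (A `&` \big[setU/set0]_(i < n) F i)) @[n --> \oo] --> fine (mu A).
Proof.
move=> mA mF AF.
have mI n : measurable (A `&` \big[setU/set0]_(i < n) F i).
  by apply: measurableI => //; exact: bigsetU_measurable.
rewrite -expect_indic//; under eq_fun do rewrite -(expect_indic mu (mI _)).
apply: (@bounded_convergence _ _ _ mu (fun n => \1_(A `&` \big[setU/set0]_(i < n) F i)) _ 1).
- by move=> n; exact: measurable_indic.
- by move=> n x; rewrite indicE normr_nat lern1 leq_b1.
- move=> x; apply: cvg_near_cst; rewrite indicE.
  have [|xA] := boolP (x \in A); last first.
    apply: nearW => n; rewrite indicE memNset//= => -[Ax _].
    by move/negP: xA; apply; rewrite inE.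
  rewrite inE => Ax; have [i _ Fix] := AF _ Ax; exists i.+1 => // n /= ltin.
  by rewrite indicE mem_set//; split => //; rewrite -bigcup_mkord; exists i.
Qed.

Lemma fine_setC mu A : measurable A -> fine (mu (~` A)) = 1 - fine (mu A).
Proof.
move=> mA; rewrite probability_setC// -(fineK (fin_num_measure mu _ mA)).
by rewrite -EFinB.
Qed.

Definition invariant_prob mu := forall t B, 0 <= t -> measurable B ->
  fine (mu B) = expect mu (fun x => fine (K t x B)).

(** By invariance [mu] is the mixture of the laws [natK N y] under [mu] itself, so its distance to
    [natK N x] is at most a mean of coalescing distances. A later real time is N + r, and time [r]
    contracts while fixing [mu]. *)
Lemma invariant_prob_cvg mu x (e : R) : invariant_prob mu -> 0 < e ->
  exists N : nat, forall t, N%:R <= t -> dtv (K t x) mu <= e.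
Proof.
move=> inv e0; have [N hN] := expect_dtv_small mu x e0.
have invf t f : 0 <= t -> unit_meas f ->
    expect mu f = expect mu (fun y => expect (K t y) f).
  by move=> t0; apply: (expect_kernel_comp KP) => // B mB; exact: inv.
exists N => t Nt; apply: le_trans (hN N (leqnn N)).
have [r r0 ->] : exists2 r, 0 <= r & t = N%:R + r.
  by exists (t - N%:R); [rewrite subr_ge0|rewrite addrC subrK].
apply: (@le_trans _ _ (dtv mu (natK N x))); last first.
  by apply: (dtv_mix rho_metric borel s KP) => // f uf; exact: invf.
apply: dtv_le => i; have ui := lfun_unit_meas rho_metric borel s i.
rewrite (semigroup_CK KP x (ler0n R N) r0 ui) (invf _ _ r0 ui) distrC.
apply: (expect_le_dtv rho_metric borel s_dense).
exact: (semigroup_unit_meas KP).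
Qed.

Lemma invariant_prob_unique mu nu : invariant_prob mu -> invariant_prob nu ->
  forall B, measurable B -> nu B = mu B.
Proof.
move=> imu inu B mB.
suff h : fine (nu B) = fine (mu B).
  by rewrite -(fineK (fin_num_measure nu _ mB)) h fineK// fin_num_measure.
apply/eqP; rewrite -subr_eq0 -normr_le0; apply/ler_addgt0Pr => e e0.
rewrite add0r.
have [N1 h1] := invariant_prob_cvg (s 0) imu (half_pos e0).
have [N2 h2] := invariant_prob_cvg (s 0) inu (half_pos e0).
have {}h1 := h1 (maxn N1 N2)%:R ltac:(by rewrite ler_nat leq_maxl).
have {}h2 := h2 (maxn N1 N2)%:R ltac:(by rewrite ler_nat leq_maxr).
apply: le_trans (measure_le_dtv rho_metric borel s_dense nu mu mB) _.
apply: le_trans (dtv_tri rho_metric borel s (K (maxn N1 N2)%:R (s 0)) _ _) _.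
by rewrite (dtv_sym rho_metric borel s nu); lra.
Qed.

(** * The limit functional, its support and its countably additive part *)

Section limit_functional.
Context (L : (nat -> R) -> R)
  (LD : forall v w, seq_bdd v -> seq_bdd w -> L (fun n => v n + w n) = L v + L w)
  (LZ : forall c v, seq_bdd v -> L (fun n => c * v n) = c * L v)
  (Lcvg : forall v l, v n @[n --> \oo] --> l -> L v = l)
  (Lle : forall v w, seq_bdd v -> seq_bdd w ->
        (\forall n \near \oo, v n <= w n) -> L v <= L w).
Context (z : X) (z_reach : asymp_reach rho K z).

Definition limf f := L (fun m => expect (natK m z) f).

Lemma expect_seq_bdd f : bdd_meas f -> seq_bdd (fun m => expect (natK m z) f).
Proof.
move=> bf; have [_ [M hM]] := bf; exists M => m.
apply: le_trans (expect_norm _ bf) _; apply: expect_le_cst => //.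
exact: bdd_meas_norm.
Qed.

Lemma limfD f g : bdd_meas f -> bdd_meas g -> limf (fun x => f x + g x) = limf f + limf g.
Proof.
move=> bf bg; rewrite /limf -LD; [|exact: expect_seq_bdd..].
by congr L; apply/funext => m; rewrite expectD.
Qed.

Lemma limfZ c f : bdd_meas f -> limf (fun x => c * f x) = c * limf f.
Proof.
move=> bf; rewrite /limf -LZ; last exact: expect_seq_bdd.
by congr L; apply/funext => m; rewrite expectZ.
Qed.

Lemma limf_cst c : limf (cst c) = c.
Proof.
by apply: Lcvg; apply: cvg_near_cst; apply: nearW => m; rewrite expect_cst.
Qed.

Lemma limf_le f g : bdd_meas f -> bdd_meas g -> (forall x, f x <= g x) -> limf f <= limf g.
Proof.
move=> bf bg fg; apply: Lle; [exact: expect_seq_bdd..|].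
by apply: nearW => m; exact: le_expect.
Qed.

(** The law at time t + m from [z] is the mixture over [K t z] of the laws at time [m], and these
    coalesce with [natK m z]; so the two sequences under [L] differ by a null sequence. *)
Lemma limf_invariant t f : 0 <= t -> unit_meas f ->
  limf (fun y => expect (K t y) f) = limf f.
Proof.
move=> t0 uf; have uK := semigroup_unit_meas KP t0 uf.
have bK := unit_meas_bdd uK; have bf := unit_meas_bdd uf.
have -> : (fun y => expect (K t y) f) = (fun y => f y + (expect (K t y) f - f y)).
  by apply/funext => y; rewrite addrC subrK.
rewrite limfD//; last exact: bdd_measB.
rewrite [X in _ + X](_ : _ = 0) ?addr0//; apply: Lcvg.
apply/cvgr0Pnorm_le => e e0; have [N hN] := expect_dtv_small (K t z) z e0.
exists N => // m /= Nm; rewrite expectB//; apply: le_trans (hN m Nm).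
have -> : expect (natK m z) (fun y => expect (K t y) f) = expect (K (t + m%:R) z) f.
  by rewrite addrC (semigroup_CK KP z (ler0n R m) t0 uf).
apply: le_trans (expect_le_dtv rho_metric borel s_dense _ _ uf) _.
apply: (dtv_mix rho_metric borel s KP) => // g ug.
by rewrite /nat_kernel (semigroup_CK KP).
Qed.

Definition lims (A : set X) := L (fun m => fine (natK m z A)).

Lemma limsE A : measurable A -> lims A = limf (\1_A).
Proof. by move=> mA; congr L; apply/funext => m; rewrite expect_indic. Qed.

Lemma fine_natK_unit m (A : set X) : 0 <= fine (natK m z A).
Proof. by apply: fine_ge0; exact: measure_ge0. Qed.

Lemma lims_ge0 A : measurable A -> 0 <= lims A.
Proof.
move=> mA; rewrite limsE// -[leLHS](limf_cst 0).
apply: limf_le; [exact: bdd_meas_cst|exact: bdd_meas_indic|].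
by move=> x; rewrite indicE ler0n.
Qed.

Lemma lims0 : lims set0 = 0.
Proof. by rewrite limsE// -[RHS](limf_cst 0) indic0. Qed.

Lemma lims_add A B : measurable A -> measurable B ->
  lims B = lims (B `&` A) + lims (B `&` ~` A).
Proof.
move=> mA mB; have mBA : measurable (B `&` A) by exact: measurableI.
have mBCA : measurable (B `&` ~` A) by apply: measurableI => //; exact: measurableC.
rewrite !limsE// -limfD; [|exact: bdd_meas_indic..].
congr limf; apply/funext => x; rewrite !indicE !in_setI in_setC.
by case: (x \in A); case: (x \in B); rewrite /= ?addr0 ?add0r.
Qed.

Lemma lims_le A B : measurable A -> measurable B -> A `<=` B -> lims A <= lims B.
Proof.
move=> mA mB AB; rewrite !limsE//; apply: limf_le; [exact: bdd_meas_indic..|].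
move=> x; rewrite !indicE; have [|] := boolP (x \in A); rewrite ?ler0n//.
by rewrite inE => /AB Bx; rewrite mem_set.
Qed.

Lemma limf_stair N f : measurable_fun setT f ->
  limf (stair N f) = N%:R^-1 * \sum_(k < N) lims (stair_level N f k).
Proof.
move=> mf; have bl k : bdd_meas (\1_(stair_level N f k) : X -> R).
  by apply: bdd_meas_indic; exact: measurable_stair_level.
rewrite /stair limfZ; last exact: (@bdd_meas_sum _ _ _ N (fun k => \1_(stair_level N f k))).
congr (_ * _).
suff h n : limf (fun x => \sum_(k < n) \1_(stair_level N f k) x) =
    \sum_(k < n) lims (stair_level N f k) by exact: h.
elim: n => [|n IH].
  by rewrite big_ord0; under eq_fun do rewrite big_ord0; exact: limf_cst.
rewrite big_ord_recr/= -IH limsE; last exact: measurable_stair_level.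
rewrite -limfD//; last exact: (@bdd_meas_sum _ _ _ n (fun k => \1_(stair_level N f k))).
by congr limf; apply/funext => x; rewrite big_ord_recr.
Qed.

Lemma expect_le_limf mu (c : R) f : 0 <= c ->
  (forall A, measurable A -> c * fine (mu A) <= lims A) -> unit_meas f ->
  c * expect mu f <= limf f.
Proof.
(* Replacing [f] by [stair] costs c/(N+1) on the left and 1/(N+1) on the right. *)
move=> c0 h uf; apply: (@le_of_natSinv _ _ _ (c + 1)) => N.
have h1 := unit_meas_stair_dist mu N uf.
have bs : bdd_meas (stair N.+1 f) by apply: bdd_meas_stair; exact: uf.1.
have h2 : limf (stair N.+1 f) <= limf f + N.+1%:R^-1.
  rewrite -[X in _ + X]limf_cst -limfD; [|exact: unit_meas_bdd|exact: bdd_meas_cst].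
  apply: limf_le => //; first by apply: bdd_measD; [exact: unit_meas_bdd|exact: bdd_meas_cst].
  move=> x; have := stair_approx (ltn0Sn N) (uf.2 x); rewrite ler_norml /=.
  by set q := (N.+1%:R^-1 : R) => /andP[? ?]; lra.
have h3 : c * expect mu (stair N.+1 f) <= limf (stair N.+1 f).
  rewrite (expect_stair _ _ uf.1) (limf_stair _ uf.1) mulrCA ler_wpM2l ?invr_ge0//.
  rewrite mulr_sumr; apply: ler_sum => k _; apply: h.
  by apply: measurable_stair_level; exact: uf.1.
have h4 : c * expect mu f <= c * (expect mu (stair N.+1 f) + N.+1%:R^-1).
  apply: ler_wpM2l => //; move: h1; rewrite ler_norml.
  by set q := (N.+1%:R^-1 : R) => /andP[? ?]; lra.
move: h2 h3 h4; rewrite mulrDr [(c + 1) * _]mulrDl mul1r.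
by set q := (N.+1%:R^-1 : R); lra.
Qed.

(** The topological support of [lims]. A finitely additive content may charge the complement of its
    support; [natK_limsupp] shows that the laws [natK m z] do not. *)
Definition limsupp : set X := [set y | forall r, 0 < r -> 0 < lims (mk_rball rho y r)].

Lemma limsupp_base : limsupp z.
Proof.
move=> r r0; have [p p0 hp] := z_reach r0; have [N hN] := hp z.
apply: lt_le_trans p0 _; rewrite -[leLHS](limf_cst p) /limf.
apply: Lle.
- by apply: expect_seq_bdd; exact: bdd_meas_cst.
- have mB : measurable (mk_rball rho z r) by exact: measurable_rball.
  have [M hM] := expect_seq_bdd (bdd_meas_indic mB).
  by exists M => m; have := hM m; rewrite expect_indic.
- by exists N => // m /= Nm; rewrite expect_cst; exact: hN.
Qed.

Lemma limsupp_closed : mk_rho_open rho (~` limsupp).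
Proof.
move=> y /existsNP[r /not_implyP[r0 /negP]]; rewrite -leNgt => h.
exists (r / 2); first exact: half_pos.
move=> w /= yw /(_ _ (half_pos r0)); apply/negP; rewrite -leNgt.
apply: le_trans h; apply: lims_le; [exact: measurable_rball..|].
move=> v; rewrite /mk_rball /= in yw * => wv.
by have := rho_tri rho_metric w y v; lra.
Qed.

(* Feller property: an open set charged by the process started at z is charged
   by the process started near z, hence by the limit functional. *)
Lemma lims_ball_null y q m : lims (mk_rball rho y q) <= 0 ->
  natK m z (mk_rball rho y q) = 0%E.
Proof.
set B := mk_rball rho y q => hB.
have mB : measurable B by exact: measurable_rball.
suff h : fine (natK m z B) <= 0.
  rewrite -(fineK (fin_num_measure (natK m z) _ mB)).
  by congr EFin; apply/eqP; rewrite eq_le h fine_natK_unit.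
rewrite leNgt; apply/negP => c0; set c := fine _ in c0.
have Lb k : mk_lipschitz rho (tent rho y q k%:R) by exact: lipschitz_tent.
have ub k : unit_meas (tent rho y q k%:R).
  split; first exact: (lipschitz_measurable rho_metric borel).
  by move=> x; exact: tent_unit.
have cv : expect (natK m z) (tent rho y q k%:R) @[k --> \oo] --> c.
  rewrite /c -expect_indic//; apply: (@bounded_convergence _ _ _ _ _ _ 1).
  - by move=> k; exact: (ub k).1.
  - by move=> k x; have /andP[? ?] := (ub k).2 x; rewrite ger0_norm.
  - by move=> x; exact: tent_cvg_indic.
(* Some tent below the indicator of [B] has mean above c/2 from [z], hence above c/4 from a whole
   ball around [z] by the Feller property. That ball has positive content, so invariance forces
   [lims B] to be positive. *)
have /cvgrPdist_lt/(_ _ (half_pos c0))/filter_ex[k hk] := cv.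
have bck := lipschitz_unit_bounded_continuous rho_metric (Lb k) (ub k).2.
have [dl dl0 hdl] := kernel_feller KP (ler0n R m) bck z (divr_gt0 c0 (ltr0n R 4)).
have mz : measurable (mk_rball rho z dl) by exact: measurable_rball.
have bK : bdd_meas (fun x => expect (K m%:R x) (tent rho y q k%:R)).
  by apply: unit_meas_bdd; exact: (semigroup_unit_meas KP).
have h1 : c / 4 * lims (mk_rball rho z dl) <= limf (fun x => expect (K m%:R x) (tent rho y q k%:R)).
  rewrite limsE// -limfZ; last exact: bdd_meas_indic.
  apply: limf_le => //; first by apply: bdd_measZ; exact: bdd_meas_indic.
  move=> x; rewrite indicE; have [|_] := boolP (x \in _); last first.
    by rewrite mulr0; have /andP[] := expect_unit (K m%:R x) (ub k).
  rewrite inE => /hdl; rewrite mulr1 ltr_norml => /andP[? ?].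
  by move: hk; rewrite ltr_norml /nat_kernel => /andP[? ?]; lra.
have h2 : limf (tent rho y q k%:R) <= lims B.
  rewrite limsE//; apply: limf_le; [exact: unit_meas_bdd|exact: bdd_meas_indic|].
  move=> x; rewrite indicE; have [_|] := boolP (x \in B).
    by have /andP[] := (ub k).2 x.
  move=> xB; rewrite tent_out// leNgt; apply/negP => h.
  by move/negP: xB; apply; rewrite inE.
have := limsupp_base dl0; rewrite limf_invariant// in h1.
have := mulr_gt0 (divr_gt0 c0 (ltr0n R 4)) (limsupp_base dl0).
by lra.
Qed.

(** The complement of [limsupp] is covered by countably many balls of content 0 around dense points.
    Each is null for [natK m z] by [lims_ball_null], and this law is countably additive. *)
Lemma natK_limsupp m A : measurable A -> A `&` limsupp = set0 -> natK m z A = 0%E.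
Proof.
move=> mA AS.
pose C n k := let B := mk_rball rho (s n) k.+1%:R^-1 in
  if lims B <= 0 then B else set0.
have : (natK m z).-negligible (\bigcup_n \bigcup_k C n k).
  apply: negligible_bigcup => n; apply: negligible_bigcup => k; rewrite /C.
  case: ifPn => [h|_]; last exact: negligible_set0.
  exists (mk_rball rho (s n) k.+1%:R^-1); split => //; first exact: measurable_rball.
  exact: lims_ball_null.
apply: contraPeq => h [N [mN N0 CN]].
move/eqP: h; apply; apply/eqP; rewrite eq_le measure_ge0 andbT -N0.
apply: le_measure; rewrite ?inE//; apply: subset_trans CN => x Ax.
have /existsNP[r /not_implyP[r0 /negP]] : ~ limsupp x.
  by move=> Sx; have : (A `&` limsupp) x by []; rewrite AS.
rewrite -leNgt => hr.
have [k hk] := exists_natSinv_lt (half_pos r0).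
have [n hn] := s_dense x (e := k.+1%:R^-1) ltac:(by rewrite invr_gt0).
exists n => //; exists k => //; rewrite /C ifT; first by rewrite /mk_rball /= (rho_sym rho_metric).
apply: le_trans hr; apply: lims_le; [exact: measurable_rball..|].
move=> y; rewrite /mk_rball /= => hy.
move: hk hn hy; set q := (k.+1%:R^-1 : R) => hk hn hy.
by have := rho_tri rho_metric (s n) x y; lra.
Qed.

(** Lower semicontinuity: the distance is a supremum of functions that are continuous by the Feller
    property. *)
Lemma dtv_sublevel_closed k (e : R) :
  mk_rho_open rho (~` [set y | dtv (natK k y) (natK k z) <= e]).
Proof.
move=> y /= /negP; rewrite -ltNge => hy.
have [i hi] : exists i, e < `|expect (natK k y) (lfun i) - expect (natK k z) (lfun i)|.
  apply: contrapT => h; move: hy; apply/negP; rewrite -leNgt; apply: dtv_le => i.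
  by rewrite leNgt; apply/negP => hi; apply: h; exists i.
have bc := lipschitz_unit_bounded_continuous rho_metric
  (lval_lipschitz rho_metric s (lterm_nth i)) (lval_unit rho s (lterm_nth i)).
rewrite -subr_gt0 in hi.
have [dl dl0 hdl] := kernel_feller KP (ler0n R k) bc y hi.
exists dl => // w /hdl; rewrite distrC => hw /=; apply/negP; rewrite -ltNge.
apply: lt_le_trans (lfun_le_dtv rho_metric borel s _ _ i).
have := ler_distD (expect (natK k w) (lfun i)) (expect (natK k y) (lfun i))
  (expect (natK k z) (lfun i)).
move: hw; rewrite /nat_kernel /lipfun; lra.
Qed.

(** Coalescence makes the sets [A k] cover the support, so Baire gives one [k] for which [A k] has
    positive content [beta]. From points of [A k] the time-[k] law is at least [natK k z] - 1/2, and
    invariance at time [k] concludes. *)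
Lemma lims_minorization : exists beta k, 0 < beta /\
  forall B, measurable B -> beta * (fine (natK k z B) - 2^-1) <= lims B.
Proof.
pose A k := [set y | dtv (natK k y) (natK k z) <= 2^-1].
have [y [r [k [Gy r0 GA]]]] : exists y r k, [/\ limsupp y, 0 < r &
    limsupp `&` mk_rball rho y r `<=` A k].
  apply: (baire_closed_cover rho_metric rho_compl limsupp_base limsupp_closed).
    by move=> k; exact: dtv_sublevel_closed.
  move=> y _; have [k hk] := K_dist0 y z (e := 2^-1) ltac:(by rewrite invr_gt0).
  by exists k => //; rewrite /A /=; rewrite add0r in hk.
have mA : measurable (A k).
  rewrite /A -[X in measurable X]setTI; apply: measurable_fun_le => //.
  exact: (natK_dtv_unit_meas rho_metric borel s KP _ _).1.
have mB0 : measurable (mk_rball rho y r) by exact: measurable_rball.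
exists (lims (A k)), k; split.
  apply: lt_le_trans (Gy r r0) _; rewrite (lims_add mA mB0).
  (* The part of the ball outside [A k] misses the support, so no law [natK m z] charges it. *)
  rewrite [X in _ + X](_ : _ = 0); last first.
    apply: Lcvg; apply: cvg_near_cst; apply: nearW => m; rewrite natK_limsupp//.
      by apply: measurableI => //; exact: measurableC.
    by apply/seteqP; split => // x [[Bx nAx] Sx]; apply: nAx; exact: GA.
  by rewrite addr0; apply: lims_le => //; exact: measurableI.
move=> B mB; rewrite (limsE mA) (limsE mB) -(limf_invariant (ler0n R k) (unit_meas_indic mB)).
rewrite mulrC -limfZ; last exact: bdd_meas_indic.
apply: limf_le; first by apply: bdd_measZ; exact: bdd_meas_indic.
  apply: unit_meas_bdd; apply: (semigroup_unit_meas KP) => //.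
  exact: unit_meas_indic.
move=> x; rewrite indicE; have [|_] := boolP (x \in A k); last first.
  by rewrite mulr0; have /andP[] := expect_unit (K k%:R x) (unit_meas_indic mB).
rewrite inE /A /= mulr1 => hx; rewrite expect_indic//.
have := measure_le_dtv rho_metric borel s_dense (natK k x) (natK k z) mB.
by rewrite ler_norml /nat_kernel => /andP[? _]; move: hx; rewrite /nat_kernel; lra.
Qed.

Lemma invariant_prob_exists_limit : exists mu, invariant_prob mu.
Proof.
have [beta [k [b0 hb]]] := lims_minorization.
(* The absolute value makes the content nonnegative on nonmeasurable sets too; on measurable sets it
   changes nothing. *)
pose nu A := `|lims A|.
have nuE A : measurable A -> nu A = lims A by move=> mA; rewrite /nu ger0_norm// lims_ge0.
have nu0 : nu set0 = 0 by rewrite nuE// lims0.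
have nu_add A B : measurable A -> measurable B -> nu B = nu (B `&` A) + nu (B `&` ~` A).
  move=> mA mB; rewrite !nuE//; first exact: lims_add.
    by apply: measurableI => //; exact: measurableC.
  exact: measurableI.
have [pi [pi_le pi_max]] := largest_measure_minorant nu0 (fun A => normr_ge0 _) nu_add.
(* The minorant beta (K k z - 1/2) has value beta/2 on the whole space, so maximality makes [pi]
   nonzero. *)
have piT : ((beta / 2)%:E <= pi setT)%E.
  have e : beta / 2 = beta * (fine (natK k z setT) - 2^-1).
    by rewrite probability_setT /=; lra.
  rewrite e; apply: (pi_max (fun B => beta * (fine (natK k z B) - 2^-1))) => //.
    by move=> B mB; rewrite nuE//; exact: hb.
  move=> F mF TF; apply: cvgMr; apply: cvgB; last exact: cvg_cst.
  exact: fine_cover_cvg.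
have piT1 : (pi setT <= 1)%E.
  apply: le_trans (pi_le _ measurableT) _; rewrite nuE// lee_fin limsE//.
  rewrite -[leRHS](limf_cst 1); apply: limf_le; [exact: bdd_meas_indic|exact: bdd_meas_cst|].
  by move=> x; rewrite indicE /cst lern1 leq_b1.
have pi_fin A : measurable A -> pi A \is a fin_num.
  move=> mA; rewrite ge0_fin_numE//; apply: le_lt_trans (ltry 1); apply: le_trans piT1.
  by apply: le_measure; rewrite ?inE.
set c := fine (pi setT).
have c0 : 0 < c.
  apply: lt_le_trans (half_pos b0) _.
  by rewrite -lee_fin /c fineK// pi_fin.
(* [natK 0 z] is the fallback for total mass 0 or infinite, both excluded by [piT] and [piT1]. *)
pose mu : probability X R := mnormalize pi (natK 0 z).
have muE A : measurable A -> c * fine (mu A) = fine (pi A).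
  move=> mA; rewrite /mu /= /mnormalize ifF; last first.
    apply/negbTE; rewrite negb_or; apply/andP; split.
      by rewrite gt_eqF// (lt_le_trans _ piT)// lte_fin half_pos.
    by rewrite lt_eqF// (le_lt_trans piT1)// ltry.
  by rewrite fineM ?pi_fin//= mulrCA mulfV ?mulr1// gt_eqF.
have mu_le A : measurable A -> c * fine (mu A) <= lims A.
  move=> mA; rewrite muE// -nuE// -lee_fin fineK ?pi_fin//; exact: pi_le.
(* The image of [pi] under the kernel is again continuous along covers and, [nu] being invariant,
   again below [nu]; maximality puts it below [pi]. *)
have inv_le t A : 0 <= t -> measurable A ->
    expect mu (fun x => fine (K t x A)) <= fine (mu A).
  move=> t0 mA; rewrite -(ler_pM2l c0) muE// -lee_fin fineK ?pi_fin//.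
  apply: (pi_max (fun B => c * expect mu (fun x => fine (K t x B)))) => //.
    move=> B mB; rewrite nuE// limsE// -(limf_invariant t0 (unit_meas_indic mB)).
    have -> : (fun x => fine (K t x B)) = (fun x => expect (K t x) (\1_B)).
      by apply/funext => x; rewrite expect_indic.
    apply: expect_le_limf => //; first exact: ltW.
    by apply: (semigroup_unit_meas KP) => //; exact: unit_meas_indic.
  move=> F mF AF; apply: cvgMr.
  have mI n : measurable (A `&` \big[setU/set0]_(i < n) F i).
    by apply: measurableI => //; exact: bigsetU_measurable.
  apply: (@bounded_convergence _ _ _ mu
    (fun n x => fine (K t x (A `&` \big[setU/set0]_(i < n) F i))) _ 1).
  - by move=> n; exact: (kernel_meas KP).
  - move=> n x; have /andP[? ?] := (kernel_unit_meas KP t0 (mI n)).2 x.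
    by rewrite ger0_norm.
  - by move=> x; exact: fine_cover_cvg.
exists mu => t B t0 mB; apply/eqP; rewrite eq_le inv_le// andbT.
(* Total masses agree, so the inequality on the complement is the reverse inequality on [B]. *)
have := inv_le t (~` B) t0 (measurableC mB).
have -> : (fun x => fine (K t x (~` B))) = (fun x => 1 - fine (K t x B)).
  by apply/funext => x; rewrite fine_setC.
rewrite fine_setC// (@expectB _ _ _ mu (cst 1)) ?expect_cst; [lra|exact: bdd_meas_cst|].
by apply: unit_meas_bdd; exact: (kernel_unit_meas KP).
Qed.

End limit_functional.

Lemma invariant_prob_exists z : asymp_reach rho K z -> exists mu, invariant_prob mu.
Proof.
move=> zr; have [L [LD LZ Lcvg Lle]] := @generalized_limit R.
exact: (invariant_prob_exists_limit LD LZ Lcvg Lle zr).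
Qed.

End invariant_measure.

(** * Laws and truncation *)

Section law.
Context {R : realType} {d : measure_display} {X : measurableType d}
  {dO : measure_display} {Om : measurableType dO}.

Lemma exists_law (Q : probability Om R) (phi : Om -> X) : measurable_fun setT phi ->
  exists mu : probability X R, forall A, mu A = Q (phi @^-1` A).
Proof.
move=> mphi.
pose f : {mfun Om >-> X} := HB.pack phi (isMeasurableFun.Build _ _ _ _ phi mphi).
pose mu : probability X R := distribution Q f.
by exists mu.
Qed.

Context (Q : probability Om R) (phi : Om -> X) (mphi : measurable_fun setT phi)
  (mu : probability X R) (muE : forall A, mu A = Q (phi @^-1` A)).

Lemma ge0_integral_law (f : X -> \bar R) : measurable_fun setT f ->
  (forall x, 0 <= f x)%E -> (\int[mu]_x f x = \int[Q]_w f (phi w))%E.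
Proof.
move=> mf f0; rewrite (eq_measure_integral (pushforward Q phi)); last first.
  by move=> A _ _; exact: muE.
by rewrite ge0_integral_pushforward.
Qed.

Lemma integral_law (f : X -> R) : measurable_fun setT f ->
  mu.-integrable setT (EFin \o f) ->
  (\int[mu]_x (f x)%:E = \int[Q]_w (f (phi w))%:E)%E.
Proof.
move=> mf /integrableP[_ fi]; rewrite (eq_measure_integral (pushforward Q phi)); last first.
  by move=> A _ _; exact: muE.
rewrite (integral_pushforward mphi)//; first exact/measurable_EFinP.
apply/integrableP; split.
  by apply/measurable_EFinP; exact: measurableT_comp.
rewrite preimage_setT -(@ge0_integral_law (fun x => `|(f x)%:E|%E))//.
by apply: measurableT_comp => //; exact/measurable_EFinP.
Qed.

End law.

(** * Truncation of unbounded functions *)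

Section truncation.
Context {R : realType} {d : measure_display} {X : measurableType d}.
Implicit Types (mu nu : probability X R) (f V : X -> R) (M : R).

Definition excess M V x := Num.max 0 (V x - M).

Definition clip M f x := Num.max (- M) (Num.min M (f x)).

Lemma clip_bdd_meas M f : 0 <= M -> measurable_fun setT f -> bdd_meas (clip M f).
Proof.
move=> M0 mf; split.
  apply: measurable_maxr; first exact: measurable_cst.
  by apply: measurable_minr => //; exact: measurable_cst.
exists M => x; rewrite ler_norml /clip le_max lexx /= ge_max ge_min lexx /= andbT.
by lra.
Qed.

Lemma clip_excess M f V x : `|f x| <= V x -> 0 <= M -> `|f x - clip M f x| <= excess M V x.
Proof.
rewrite ler_norml => /andP[? ?] ?; rewrite ler_norml /clip /excess.
by case: (leP M (f x)) => ?; [case: (leP (- M) M) => ?|case: (leP (- M) (f x)) => ?];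
  case: (leP 0 (V x - M)) => ?; apply/andP; split; lra.
Qed.

Lemma measurable_excess M V : measurable_fun setT V -> measurable_fun setT (excess M V).
Proof.
move=> mV; apply: measurable_maxr; first exact: measurable_cst.
by apply: measurable_funB => //; exact: measurable_cst.
Qed.

(** [f] is the bounded function [clip M f] plus a remainder dominated by [excess M V]. *)
Lemma truncated_integral mu f V M (e : R) : measurable_fun setT f -> measurable_fun setT V ->
  (forall x, `|f x| <= V x) -> 0 <= M ->
  (\int[mu]_x (excess M V x)%:E <= e%:E)%E ->
  mu.-integrable setT (EFin \o f) /\
  `|fine (\int[mu]_x (f x)%:E)%E - expect mu (clip M f)| <= e.
Proof.
move=> mf mV fV M0 He.
have mW := measurable_excess M mV.
have W0 x : 0 <= excess M V x by rewrite le_max lexx.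
have iW : mu.-integrable setT (EFin \o excess M V).
  apply/integrableP; split; first exact/measurable_EFinP.
  under eq_integral => x _ do rewrite /= ger0_norm//.
  exact: le_lt_trans He (ltry _).
have bc := clip_bdd_meas M0 mf; have ic := bdd_meas_integrable mu bc.
pose h x := f x - clip M f x.
have mh : measurable_fun setT h by apply: measurable_funB => //; exact: bc.1.
have ih : mu.-integrable setT (EFin \o h).
  apply: le_integrable iW => //; first exact/measurable_EFinP.
  by move=> x _ /=; rewrite lee_fin [leRHS]ger0_norm//; exact: clip_excess.
have fE : f = (fun x => clip M f x + h x).
  by apply/funext => x; rewrite /h addrC subrK.
have fi : mu.-integrable setT (EFin \o f).
  rewrite fE; rewrite (_ : EFin \o _ = (EFin \o clip M f) \+ (EFin \o h))//.
  exact: integrableD.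
split => //.
rewrite -[fine _]/(Rintegral mu setT f) -(@RintegralB _ _ _ mu setT f (clip M f))//.
apply: le_trans (@le_normr_Rintegral _ _ _ mu setT h measurableT ih) _.
rewrite -lee_fin; apply: (le_trans _ He).
rewrite -[X in (_ <= X)%E]fineK; last first.
  rewrite ge0_fin_numE; last by apply: integral_ge0 => x _; rewrite lee_fin.
  exact: le_lt_trans He (ltry _).
rewrite lee_fin; apply: le_Rintegral => //.
  by apply: integrable_norm.
by move=> x _; exact: clip_excess.
Qed.

(** The affine map y -> (y + M)/(2M) brings [clip M f] into [0,1], whence the factor 2M. *)
Lemma clip_expect_close mu nu f M (D : R) : measurable_fun setT f -> 0 < M ->
  (forall g, unit_meas g -> `|expect mu g - expect nu g| <= D) ->
  `|expect mu (clip M f) - expect nu (clip M f)| <= 2 * M * D.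
Proof.
move=> mf M0 h; have bc := clip_bdd_meas (ltW M0) mf.
have M20 : 0 < 2 * M by rewrite mulr_gt0.
pose g x := (2 * M)^-1 * (clip M f x + M).
have bg : bdd_meas (fun x => clip M f x + M) by apply: bdd_measD => //; exact: bdd_meas_cst.
have ug : unit_meas g.
  split; first exact: (bdd_measZ _ bg).1.
  move=> x; rewrite /g; apply/andP; split.
    apply: mulr_ge0; first by rewrite invr_ge0 ltW.
    by rewrite -lerBlDr sub0r le_max lexx.
  rewrite ler_pdivrMl// mulr1 /clip -lerBrDr ge_max; apply/andP; split; first lra.
  by rewrite ge_min; apply/orP; left; lra.
have gE (m : probability X R) : expect m g = (2 * M)^-1 * (expect m (clip M f) + M).
  by rewrite expectZ// expectD// ?expect_cst//; exact: bdd_meas_cst.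
have := h g ug; rewrite !gE -mulrBr opprD addrACA subrr addr0 normrM.
by rewrite ger0_norm ?invr_ge0 ?(ltW M20)// ler_pdivrMl.
Qed.

(** A Fatou property: the bound passes to the limit for each bounded truncation of [W], then to [W]
    by monotone convergence. *)
Lemma ge0_integral_setwise_le mu (W : X -> R) (nu_ : nat -> probability X R) (C : R) :
  measurable_fun setT W -> (forall x, 0 <= W x) ->
  (forall e, 0 < e -> exists n, forall g, unit_meas g ->
     `|expect (nu_ n) g - expect mu g| <= e) ->
  (forall n, (\int[nu_ n]_x (W x)%:E <= C%:E)%E) ->
  (\int[mu]_x (W x)%:E <= C%:E)%E.
Proof.
move=> mW W0 cv hC.
pose g N x := Num.min N%:R (W x).
have mg N : measurable_fun setT (g N) by apply: measurable_minr => //; exact: measurable_cst.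
have g0 N x : 0 <= g N x by rewrite le_min ler0n W0.
have bg N : bdd_meas (g N).
  by split => //; exists N%:R => x; rewrite ger0_norm// ge_min lexx.
have gC N : expect mu (g N) <= C.
  apply/ler_addgt0Pr => e e0.
  (* Scaling by 1/(N+1) instead of 1/N also covers N = 0. *)
  have Np : (0 : R) < N.+1%:R by [].
  have [n hn] := cv _ (divr_gt0 e0 Np).
  pose h x := N.+1%:R^-1 * g N x.
  have uh : unit_meas h.
    split; first exact: (bdd_measZ _ (bg N)).1.
    move=> x; apply/andP; split; first by rewrite mulr_ge0// invr_ge0.
    rewrite ler_pdivrMl// mulr1; apply: (@le_trans _ _ N%:R); first by rewrite ge_min lexx.
    by rewrite ler_nat.
  have hE (m : probability X R) : expect m h = N.+1%:R^-1 * expect m (g N) by rewrite expectZ.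
  have := hn h uh; rewrite !hE -mulrBr normrM ger0_norm ?invr_ge0//.
  rewrite ler_pdivrMl// mulrC divfK ?gt_eqF// ler_norml => /andP[h1 _].
  have : expect (nu_ n) (g N) <= C.
    rewrite -lee_fin EFin_expect//; apply: le_trans (hC n).
    apply: ge0_le_integral => //.
    - by move=> x _; rewrite lee_fin.
    - exact/measurable_EFinP.
    - exact/measurable_EFinP.
    - by move=> x _; rewrite lee_fin ge_min lexx orbT.
  by lra.
have cvg_g := @cvg_monotone_convergence _ _ _ mu setT measurableT (fun N x => (g N x)%:E)
  (fun N => (measurable_EFinP _ _).2 (mg N)) (fun N x _ => g0 N x)
  ltac:(by move=> x _ n m nm; rewrite lee_fin le_min !ge_min lexx orbT andbT ler_nat nm).
rewrite (_ : (\int[mu]_x (W x)%:E)%E = (\int[mu]_x (limn (fun N => (g N x)%:E)))%E).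
  apply: (cvge_to_le cvg_g); apply: nearW => N.
  by rewrite -EFin_expect// lee_fin.
apply: eq_integral => x _; apply/esym/cvg_lim => //; apply: cvg_near_cst.
near=> N; congr EFin; apply/min_idPr; near: N; exact: nbhs_infty_ger.
Unshelve. all: by end_near.
Qed.

End truncation.

(** * The process *)

Section limits_at_infinity.
Context {R : realType}.
Implicit Types (f : R -> \bar R) (a : \bar R).

Lemma exists_nat_gt (T : R) : exists n : nat, T < n%:R.
Proof.
by exists (Num.bound `|T|); exact: le_lt_trans (ler_norm _) (archi_boundP (normr_ge0 T)).
Qed.

Lemma limf_esup_lt f a : (limf_esup f (pinfty_nbhs R) < a)%E ->
  exists T, forall t, T < t -> (f t < a)%E.
Proof.
move=> /ereal_inf_lt[_ [V [T [_ TV]] <-] h]; exists T => t /TV Vt.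
by apply: le_lt_trans h; apply: ereal_sup_ubound; exists t.
Qed.

Lemma limf_esup_le f a T : (forall t, T < t -> (f t <= a)%E) ->
  (limf_esup f (pinfty_nbhs R) <= a)%E.
Proof.
move=> h; apply: (@le_trans _ _ (ereal_sup [set f t | t in [set t | T < t]])).
  by apply: ereal_inf_lbound; exists [set t | T < t] => //; exists T; split; [exact: num_real|].
by apply: ge_ereal_sup => _ [t Tt <-]; exact: h.
Qed.

Lemma limf_esup_ge0 f : (forall t, (0 <= f t)%E) -> (0 <= limf_esup f (pinfty_nbhs R))%E.
Proof.
move=> h; apply: le_ereal_inf_tmp => _ [V [T [_ TV]] <-].
apply: le_trans (h (T + 1)) _; apply: ereal_sup_ubound; exists (T + 1) => //.
by apply: TV; rewrite ltrDl.
Qed.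

Lemma limf_einf_gt f a : (a < limf_einf f (pinfty_nbhs R))%E ->
  exists T, forall t, T < t -> (a < f t)%E.
Proof.
rewrite /limf_einf lteNr => /limf_esup_lt[T hT]; exists T => t /hT.
by rewrite lteN2.
Qed.

Lemma limf_einf_ge f a T : (forall t, T < t -> (a <= f t)%E) ->
  (a <= limf_einf f (pinfty_nbhs R))%E.
Proof.
move=> h; rewrite /limf_einf leeNr; apply: (@limf_esup_le _ _ T) => t /h.
by rewrite leeN2.
Qed.

Lemma pinfty_cvg0_le f (e : R) : f t @[t --> +oo] --> 0%E -> 0 < e ->
  exists T, forall t, T < t -> (f t <= e%:E)%E.
Proof.
move=> /fine_cvgP[[T1 [_ h1]]] /cvgr0Pnorm_le h e0; have [T2 [_ h2]] := h _ e0.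
exists (Num.max T1 T2) => t; rewrite gt_max => /andP[t1 t2].
rewrite -(fineK (h1 _ t1)) lee_fin; apply: le_trans (ler_norm _) (h2 _ t2).
Qed.

Lemma pinfty_cvg0 f : (forall t, (0 <= f t)%E) ->
  (forall e, 0 < e -> exists T, forall t, T < t -> (f t <= e%:E)%E) ->
  f t @[t --> +oo] --> 0%E.
Proof.
move=> f0 h; apply/fine_cvgP; split.
  have [T hT] := h 1 ltr01; exists T; split; first exact: num_real.
  by move=> t /hT ft; rewrite ge0_fin_numE// (le_lt_trans ft)// ltry.
apply/cvgr0Pnorm_le => e e0; have [T hT] := h e e0.
exists T; split; first exact: num_real.
move=> t /hT ft /=; rewrite ger0_norm ?fine_ge0// -lee_fin fineK//.
by rewrite ge0_fin_numE// (le_lt_trans ft)// ltry.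
Qed.

End limits_at_infinity.

(** * From the process to its laws, and the implications of the theorem *)

Section process.
Context {R : realType} {d : measure_display} {X : measurableType d}
  {dO : measure_display} {Om : measurableType dO}.
Context (rho : X -> X -> R) (P : X -> probability Om R) (Phi : R -> Om -> X) (F : set (X -> R)).
Context (rho_metric : mk_is_metric rho) (rho_compl : mk_rho_complete rho)
  (s : nat -> X) (s_dense : forall x (e : R), 0 < e -> exists n, rho x (s n) < e)
  (borel : mk_borel_of rho) (markov : mk_markov_family P Phi) (feller : mk_feller rho P Phi).
Context (F_meas : forall f, F f -> measurable_fun setT f)
  (F_lip : forall f : X -> R, mk_lipschitz rho f -> (forall x, `|f x| <= 1) -> F f).

Let Phi_meas (t : R) : 0 <= t -> measurable_fun setT (Phi t).
Proof. by case: markov => h _ _ _; exact: h. Qed.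

Lemma exists_transition_law : exists K : R -> X -> probability X R,
  forall t x A, 0 <= t -> K t x A = P x (Phi t @^-1` A).
Proof.
(* The absolute value provides a law at negative times as well, so that [K] is total. *)
have h (t : R) x := exists_law (P x) (Phi_meas (normr_ge0 t)).
exists (fun t x => sval (cid (h t x))) => t x A t0.
by rewrite (svalP (cid (h t x))) ger0_norm.
Qed.

Context (K : R -> X -> probability X R)
  (KE : forall t x A, 0 <= t -> K t x A = P x (Phi t @^-1` A)).

Let KEt (t : R) x (t0 : 0 <= t) A := KE x A t0.

Lemma Ptf_law t x f : 0 <= t -> measurable_fun setT f ->
  (K t x).-integrable setT (EFin \o f) ->
  mk_Ptf P Phi t f x = (\int[K t x]_y (f y)%:E)%E.
Proof.
by move=> t0 mf fi; rewrite (integral_law (Phi_meas t0) (KEt x t0)).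
Qed.

Lemma Ptf_expect t x f : 0 <= t -> bdd_meas f ->
  mk_Ptf P Phi t f x = (expect (K t x) f)%:E.
Proof.
move=> t0 bf; rewrite EFin_expect// Ptf_law//; first exact: bf.1.
exact: bdd_meas_integrable.
Qed.

Lemma transition_law_semigroup : feller_semigroup rho K.
Proof.
have [_ _ Pt_meas Pt_markov] := markov; split.
- move=> t B t0 mB; apply: measurableT_comp => //.
  rewrite (_ : (fun x => _) = (fun x => mk_Pt P Phi t x B)); first exact: Pt_meas.
  by apply/funext => x; rewrite KE.
- move=> u t x B u0 t0 mB; rewrite KE ?addr_ge0//.
  (* With no constraint on the past, the Markov property is the Chapman-Kolmogorov equation. *)
  have := Pt_markov x u t u0 t0 0%N (fun=> 0) (fun=> setT) B.
  rewrite !bigcap_mkord !big_ord0 setTI => ->//; last by move=> _; rewrite lexx u0.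
  have mK : measurable_fun setT (fun y => K t y B).
    rewrite (_ : (fun x => _) = (fun x => mk_Pt P Phi t x B)); first exact: Pt_meas.
    by apply/funext => y; rewrite KE.
  rewrite /expect /Rintegral; congr fine.
  under [RHS]eq_integral => y _ do rewrite fineK ?fin_num_measure//.
  rewrite (ge0_integral_law (Phi_meas u0) (KEt x u0))//.
  by apply: eq_integral => w _; rewrite KE.
- move=> t f t0 bcf x; have := feller t0 bcf x.
  have bf : bdd_meas f.
    by split; [apply: (continuous_measurable borel); exact: bcf.2|exact: bcf.1].
  rewrite (_ : (fun y => fine _) = (fun y => expect (K t y) f))//.
  by apply/funext => y; rewrite (Ptf_expect y t0 bf).
Qed.

Let KP := transition_law_semigroup.

Lemma lfun_in_F i : F (lipfun rho s i).
Proof.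
apply: F_lip; first exact: (lval_lipschitz rho_metric).
by move=> x; have /andP[? ?] := lval_unit rho s (lterm_nth i) x; rewrite ger0_norm.
Qed.

(** [F] contains every [lipfun], so the supremum over [F] dominates the total variation distance;
    one integer time past the threshold suffices. *)
Lemma ev_continuous_asymp_cont z : mk_unif_ev_continuous_at rho P Phi F z ->
  asymp_cont rho s K z.
Proof.
move=> ev e e0.
have : (ereal_inf [set ereal_sup
      [set limf_esup (fun t : R => ereal_sup
             [set `|mk_Ptf P Phi t f x' - mk_Ptf P Phi t f z| | f in F])
           (pinfty_nbhs R) | x' in mk_rball rho z dl]
    | dl in [set dl : R | (0 < dl)%R]] < e%:E)%E by rewrite ev lte_fin.
move=> /ereal_inf_lt[_ [dl dl0 <-] h]; exists dl => // x zx.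
have : (limf_esup (fun t : R => ereal_sup
             [set `|mk_Ptf P Phi t f x - mk_Ptf P Phi t f z| | f in F])
           (pinfty_nbhs R) < e%:E)%E.
  by apply: le_lt_trans h; apply: ereal_sup_ubound; exists x.
move=> /limf_esup_lt[T hT].
have [n hn] := exists_nat_gt T.
exists n; apply: dtv_le => i.
have bi := unit_meas_bdd (lfun_unit_meas rho_metric borel s i).
rewrite -lee_fin; apply: le_trans (ltW (hT _ hn)); apply: ereal_sup_ubound.
by exists (lipfun rho s i); [exact: lfun_in_F|rewrite !Ptf_expect// -EFinB].
Qed.

Lemma C1_asymp_reach z : mk_C1 rho P Phi z -> asymp_reach rho K z.
Proof.
move=> C1 r r0; have := C1 r r0; set I := ereal_inf _ => I0.
have [p p0 pI] : exists2 p : R, 0 < p & (p%:E < I)%E.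
  case: I I0 => [q q0|_|//]; last by exists 1 => //; exact: ltry.
  by exists (q / 2); [exact: half_pos|rewrite lte_fin; rewrite lte_fin in q0; lra].
exists p => // x.
have : (p%:E < limf_einf (fun t : R => mk_Pt P Phi t x (mk_rball rho z r)) (pinfty_nbhs R))%E.
  by apply: lt_le_trans pI _; apply: ereal_inf_lbound; exists x.
move=> /limf_einf_gt[T hT]; have [N TN] := exists_nat_gt T; exists N => n hn.
have Tn : T < n%:R by apply: lt_le_trans TN _; rewrite ler_nat.
have mB : measurable (mk_rball rho z r) by exact: measurable_rball.
rewrite -lee_fin fineK ?fin_num_measure// KE//; exact: ltW (hT _ Tn).
Qed.

Lemma mk_invariantP mu : mk_invariant P Phi mu <-> invariant_prob K mu.
Proof.
have e t B : 0 <= t -> measurable B -> (\int[mu]_x mk_Pt P Phi t x B)%E =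
    (expect mu (fun x => fine (K t x B)))%:E.
  move=> t0 mB; rewrite EFin_expect; last first.
    by apply: unit_meas_bdd; exact: (kernel_unit_meas KP).
  by apply: eq_integral => x _; rewrite fineK ?fin_num_measure// KE.
split => inv t B t0 mB.
  by have := inv t B t0 mB; rewrite e// => <-.
by rewrite e// -(inv _ _ t0 mB) fineK ?fin_num_measure.
Qed.

Context (V : X -> R) (V_A : mk_in_A P Phi V) (FV : forall f x, F f -> `|f x| <= V x)
  (V_ui : forall x, (fun M : R => ereal_sup
            [set \int[P x]_(w in [set w | (M <= `|V (Phi t w)|)%R])
                   `|V (Phi t w)|%:E | t in [set t : R | (0 <= t)%R]])%E
            @ pinfty_nbhs R --> 0%E).

Let mV : measurable_fun setT V. Proof. exact: V_A.1. Qed.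

Lemma F0 : F (cst 0).
Proof. by apply: F_lip => [|x]; [exact: lipschitz_cst|rewrite normr0]. Qed.

Lemma F_integrable t x f : 0 <= t -> F f -> (K t x).-integrable setT (EFin \o f).
Proof.
move=> t0 Ff; apply/integrableP; split; first exact/measurable_EFinP/F_meas.
apply: le_lt_trans (V_A.2 x t t0).
rewrite -(ge0_integral_law (Phi_meas t0) (KEt x t0) (f := fun y => `|V y|%:E))//; last first.
  by apply/measurable_EFinP; exact: measurableT_comp.
apply: ge0_le_integral => //.
- by apply/measurable_EFinP; apply: measurableT_comp => //; exact: F_meas.
- by apply/measurable_EFinP; exact: measurableT_comp.
- by move=> y _; rewrite lee_fin (le_trans (FV y Ff))// ler_norm.
Qed.

Lemma excess_small x (e : R) : 0 < e -> exists2 M, 0 < M & forall t, 0 <= t ->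
  (\int[K t x]_y (excess M V y)%:E <= e%:E)%E.
Proof.
move=> e0; have [T hT] := pinfty_cvg0_le (V_ui x) e0.
(* A level that is both positive and above [T]; the excess over it is at most V on the set where |V|
   >= M. *)
pose M := Num.max T 0 + 1; exists M; first by rewrite ltr_wpDl// le_max lexx orbT.
have M0 : 0 <= M by rewrite addr_ge0// le_max lexx orbT.
have TM : T < M by rewrite (@le_lt_trans _ _ (Num.max T 0)) ?le_max ?lexx// ltrDl.
move=> t t0; apply: le_trans (hT _ TM).
apply: (@le_trans _ _ (\int[P x]_(w in [set w | (M <= `|V (Phi t w)|)%R])
  `|V (Phi t w)|%:E)%E); last first.
  by apply: ereal_sup_ubound; exists t.
have mW := measurable_excess M mV.
have W0 y : 0 <= excess M V y by rewrite le_max lexx.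
have mWE : measurable_fun setT (fun y => (excess M V y)%:E) by exact/measurable_EFinP.
rewrite (ge0_integral_law (Phi_meas t0) (KEt x t0) mWE W0).
rewrite [leRHS]integral_mkcond.
have mVP : measurable_fun setT (fun w => `|V (Phi t w)|).
  by apply: measurableT_comp => //; apply: measurableT_comp => //; exact: Phi_meas.
have mD : measurable [set w | M <= `|V (Phi t w)|].
  by rewrite -[X in measurable X]setTI; exact: measurable_fun_le (measurable_cst _) mVP.
apply: ge0_le_integral => //.
- by move=> w _; rewrite lee_fin.
- apply/measurable_EFinP; apply: measurableT_comp => //; exact: Phi_meas.
- apply/(measurable_restrictT _ mD); apply: measurable_funTS; exact/measurable_EFinP.
- move=> w _; rewrite patchE; case: ifPn => [_|].
    rewrite lee_fin /excess ge_max normr_ge0 /=.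
    by have := ler_norm (V (Phi t w)); lra.
  rewrite notin_setE /= => /negP; rewrite -ltNge => h.
  rewrite lee_fin /excess ge_max lexx /=.
  by have := ler_norm (V (Phi t w)); lra.
Qed.

Lemma asymp_stable z : mk_unif_ev_continuous_at rho P Phi F z -> mk_C1 rho P Phi z ->
  mk_unif_asympt_stable P Phi F.
Proof.
move=> /ev_continuous_asymp_cont zc /C1_asymp_reach zr.
have K0 := asymp_dist0 rho_metric borel s_dense KP zc zr.
have [mu inv] := invariant_prob_exists rho_metric rho_compl borel s_dense KP K0 zr.
have cv x e : 0 < e -> exists N : nat, forall t, N%:R <= t -> forall g, unit_meas g ->
    `|expect (K t x) g - expect mu g| <= e.
  move=> e0; have [N hN] := invariant_prob_cvg rho_metric borel s_dense KP K0 x inv e0.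
  exists N => t Nt g ug; apply: le_trans (hN t Nt).
  exact: (expect_le_dtv rho_metric borel s_dense).
(* Uniform integrability along one trajectory of laws is inherited by their limit [mu]. *)
have mu_excess x M (e : R) : (forall t, 0 <= t -> (\int[K t x]_y (excess M V y)%:E <= e%:E)%E) ->
    (\int[mu]_y (excess M V y)%:E <= e%:E)%E.
  move=> h; apply: (@ge0_integral_setwise_le _ _ _ mu _ (fun n => K n%:R x)).
  - exact: measurable_excess.
  - by move=> y; rewrite le_max lexx.
  - by move=> r r0; have [N hN] := cv x r r0; exists N; exact: hN.
  - by move=> n; exact: h.
have Fmu f : F f -> mu.-integrable setT (EFin \o f).
  move=> Ff; have [M M0 hM] := excess_small (s 0) ltr01.
  have [] := @truncated_integral _ _ _ mu f V M 1 (F_meas Ff) mV (fun x => FV x Ff) (ltW M0)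
    (mu_excess _ _ _ hM).
  by [].
exists mu; split => //.
- exact/mk_invariantP.
- move=> nu /mk_invariantP inu B mB.
  exact: (invariant_prob_unique rho_metric borel s_dense KP K0 inv inu).
- move=> x; apply: pinfty_cvg0.
    move=> t; apply: le_trans (abse_ge0 _) _; apply: ereal_sup_ubound.
    by exists (cst 0) => //; exact: F0.
  move=> e e0; have e40 : 0 < e / 4 by rewrite divr_gt0.
  have [M M0 hM] := excess_small x e40.
  (* Error budget: e/4 for truncating under [K t x], e/4 under [mu], and 2M times e/(4M) = e/2 for
     the clipped function, uniformly over [F]. *)
  have M40 : 0 < e / (4 * M) by rewrite divr_gt0// mulr_gt0.
  have [N hN] := cv x _ M40.
  exists N%:R => t Nt; have t0 : 0 <= t by rewrite (le_trans _ (ltW Nt)).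
  apply: ge_ereal_sup => _ [f Ff <-].
  have mf := F_meas Ff.
  have Kf := F_integrable x t0 Ff.
  rewrite (Ptf_law t0 mf Kf).
  have [_ h1] := truncated_integral mf mV (fun x => FV x Ff) (ltW M0) (hM t t0).
  have [_ h2] := truncated_integral mf mV (fun x => FV x Ff) (ltW M0) (mu_excess _ _ _ hM).
  have h3 := clip_expect_close mf M0 (hN t (ltW Nt)).
  have e3 : 2 * M * (e / (4 * M)) = e / 2 by field; rewrite gt_eqF.
  rewrite e3 in h3.
  rewrite -(fineK (integrable_fin_num _ Kf))// -(fineK (integrable_fin_num _ (Fmu f Ff)))//.
  rewrite -EFinB lee_fin; move: h1 h2 h3; rewrite !ler_norml.
  by move=> /andP[? ?] /andP[? ?] /andP[? ?]; apply/andP; split; lra.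
Qed.

(** From both [x] and [x'] the values tend to the mean under [mu] uniformly over [F], so the inner
    limsup vanishes for every [x'] and any radius, here 1, serves. *)
Lemma stable_ev_continuous : mk_unif_asympt_stable P Phi F ->
  mk_unif_ev_continuous rho P Phi F.
Proof.
move=> [mu [_ _ Fmu cv]] x.
apply/eqP; rewrite eq_le; apply/andP; split; last first.
  apply: le_ereal_inf_tmp => _ [dl dl0 <-].
  apply: le_trans (ereal_sup_ubound _); last first.
    by exists x => //; rewrite /mk_rball /= (rho_xx rho_metric).
  apply: limf_esup_ge0 => t; apply: le_trans (abse_ge0 _) _.
  by apply: ereal_sup_ubound; exists (cst 0) => //; exact: F0.
apply: le_trans (ereal_inf_lbound _) _; first by exists 1 => //; exact: ltr01.
apply: ge_ereal_sup => _ [x' _ <-]; apply/lee_addgt0Pr => e e0; rewrite add0e.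
have [T1 h1] := pinfty_cvg0_le (cv x) (half_pos e0).
have [T2 h2] := pinfty_cvg0_le (cv x') (half_pos e0).
apply: (@limf_esup_le _ _ _ (Num.max 0 (Num.max T1 T2))) => t.
rewrite !gt_max => /and3P[t0 tT1 tT2]; apply: ge_ereal_sup => _ [f Ff <-].
have t0' := ltW t0; have mf := F_meas Ff.
have mu_f : (\int[mu]_y (f y)%:E)%E \is a fin_num.
  by apply: integrable_fin_num => //; exact: Fmu.
have bound y : (ereal_sup [set `|mk_Ptf P Phi t f y - \int[mu]_y (f y)%:E| | f in F]
      <= (e / 2)%:E)%E ->
    exists2 a, mk_Ptf P Phi t f y = a%:E & `|a - fine (\int[mu]_y (f y)%:E)%E| <= e / 2.
  move=> h; have Kf := F_integrable y t0' Ff.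
  have Pfin : mk_Ptf P Phi t f y \is a fin_num.
    by rewrite (Ptf_law t0' mf Kf); exact: integrable_fin_num.
  exists (fine (mk_Ptf P Phi t f y)); first by rewrite fineK.
  rewrite -lee_fin; apply: le_trans h; apply: ereal_sup_ubound; exists f => //.
  by rewrite -[RHS]/(`|(fine _ - fine _)%:E|%E) EFinB !fineK.
have [a -> ha] := bound _ (h1 _ tT1); have [b -> hb] := bound _ (h2 _ tT2).
rewrite -EFinB lee_fin; move: ha hb; rewrite !ler_norml => /andP[? ?] /andP[? ?].
by apply/andP; split; lra.
Qed.

(** Otherwise countably many null balls around dense points would cover the space. *)
Lemma exists_support_point (mu : probability X R) :
  exists z, forall r, 0 < r -> 0 < fine (mu (mk_rball rho z r)).
Proof.
apply: contrapT => nz.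
pose C n k := let B := mk_rball rho (s n) k.+1%:R^-1 in
  if mu B == 0%E then B else set0.
have : mu.-negligible (\bigcup_n \bigcup_k C n k).
  apply: negligible_bigcup => n; apply: negligible_bigcup => k; rewrite /C.
  case: ifPn => [/eqP h|_]; last exact: negligible_set0.
  by exists (mk_rball rho (s n) k.+1%:R^-1); split => //; exact: measurable_rball.
move=> [N [mN N0 CN]].
suff NT : N = setT by move: N0; rewrite NT (probability_setT mu) => /eqP; rewrite eqe oner_eq0.
apply/seteqP; split => // x _; apply: CN.
have [r r0 hr] : exists2 r, 0 < r & fine (mu (mk_rball rho x r)) <= 0.
  apply: contrapT => h; apply: nz; exists x => r r0; rewrite ltNge; apply/negP => hr.
  by apply: h; exists r.
have [k hk] := exists_natSinv_lt (half_pos r0).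
have [n hn] := s_dense x (e := k.+1%:R^-1) ltac:(by rewrite invr_gt0).
have mxr : measurable (mk_rball rho x r) by exact: measurable_rball.
have msn : measurable (mk_rball rho (s n) k.+1%:R^-1) by exact: measurable_rball.
exists n => //; exists k => //; rewrite /C ifT; first by rewrite /mk_rball /= (rho_sym rho_metric).
rewrite eq_le measure_ge0 andbT.
apply: (@le_trans _ _ (mu (mk_rball rho x r))); last first.
  by rewrite -(fineK (fin_num_measure mu _ mxr)) lee_fin.
apply: le_measure; rewrite ?inE// => y; rewrite /mk_rball /= => hy.
move: hk hn hy; set q := (k.+1%:R^-1 : R) => hk hn hy.
by have := rho_tri rho_metric (s n) x y; lra.
Qed.

Lemma stable_C1 : mk_unif_asympt_stable P Phi F -> exists z, mk_C1 rho P Phi z.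
Proof.
move=> [mu [_ _ Fmu cv]]; have [z hz] := exists_support_point mu.
exists z => r r0; have r20 := half_pos r0.
set p := fine (mu (mk_rball rho z (r / 2))); have p0 : 0 < p := hz _ r20.
(* With slope 2/r the tent equals 1 on the ball of radius r/2 and 0 off the ball of radius [r], so
   its mean lies between the masses of these balls. Convergence within p/2 then leaves mass at least
   p/2, the same for all starting points. *)
have k0 : 0 <= 2 / r by rewrite divr_ge0// ltW.
pose f := tent rho z r (2 / r).
have Lf : mk_lipschitz rho f by exact: lipschitz_tent.
have f01 x : 0 <= f x <= 1 by exact: tent_unit.
have uf : unit_meas f by split => //; exact: (lipschitz_measurable rho_metric borel).
have bf := unit_meas_bdd uf.
have Ff : F f by apply: F_lip => // x; have /andP[? ?] := f01 x; rewrite ger0_norm.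
have mB q : measurable (mk_rball rho z q) by exact: measurable_rball.
have pf : p <= expect mu f.
  rewrite /p -expect_indic//; apply: le_expect => //; first exact: bdd_meas_indic.
  move=> x; rewrite indicE; have [|_] := boolP (x \in _); last by have /andP[] := f01 x.
  rewrite inE /mk_rball /= => hx; rewrite /f tent_eq1//.
  by rewrite mulrAC ler_pdivlMr//; lra.
apply: (@lt_le_trans _ _ (p / 2)%:E); first by rewrite lte_fin half_pos.
apply: le_ereal_inf_tmp => _ [x _ <-].
have [T hT] := pinfty_cvg0_le (cv x) (half_pos p0).
apply: (@limf_einf_ge _ _ _ (Num.max 0 T)) => t; rewrite gt_max => /andP[t0 tT].
have t0' := ltW t0.
have : `|expect (K t x) f - expect mu f| <= p / 2.
  rewrite -lee_fin; apply: le_trans (hT _ tT); apply: ereal_sup_ubound; exists f => //.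
  by rewrite Ptf_expect// -EFin_expect// -EFinB.
rewrite ler_norml => /andP[h _].
rewrite /mk_Pt -KE// -(fineK (fin_num_measure (K t x) _ (mB r))) lee_fin.
apply: (@le_trans _ _ (expect (K t x) f)); first by lra.
rewrite -expect_indic//; apply: le_expect => //; first exact: bdd_meas_indic.
move=> y; rewrite indicE; have [_|] := boolP (y \in _); first by have /andP[] := f01 y.
move=> yB; rewrite /f tent_out// leNgt; apply/negP => hy.
by move/negP: yB; apply; rewrite inE.
Qed.

End process.

Unset Implicit Arguments.

Theorem mainTheorem4 (R : realType) (d : measure_display) (X : measurableType d)
  (rho : X -> X -> R) (dO : measure_display) (Om : measurableType dO)
  (P : X -> probability Om R) (Phi : R -> Om -> X) (F : set (X -> R)) :
  mk_polish rho -> mk_borel_of rho -> mk_cadlag_feller_markov rho P Phi ->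
  (forall f, F f -> measurable_fun setT f) ->
  (forall f : X -> R, mk_lipschitz rho f -> (forall x : X, `|f x| <= 1) -> F f) ->
  mk_H2 P Phi F ->
  [<-> mk_unif_asympt_stable P Phi F;
       mk_unif_ev_continuous rho P Phi F /\ (exists z, mk_C1 rho P Phi z);
       exists z, mk_unif_ev_continuous_at rho P Phi F z /\ mk_C1 rho P Phi z].
Proof.
move=> [rho_metric rho_compl [s s_dense]] borel [markov feller _] F_meas F_lip.
move=> [V [V_A FV V_ui]].
have [K KE] := exists_transition_law markov.
tfae.
- move=> stable; split.
    exact: (stable_ev_continuous rho_metric markov F_meas F_lip KE V_A FV).
  exact: (stable_C1 rho_metric s_dense borel markov F_lip KE).
- by move=> [ev [z C1]]; exists z.
- move=> [z [ev C1]].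
  exact: (asymp_stable rho_metric rho_compl s_dense borel markov feller F_meas F_lip
    KE V_A FV V_ui ev C1).
Qed.
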